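(* Let $b>0$, let $W\sim\mathrm{Laplace}(0,b)$, and define the operator $\mathcal{A}$ by \[ (\mathcal{A}f)(x)=f(x)-f(0)-b^{2}f''(x). \] (i) $\mathbb{E}[(\mathcal{A}g)(W)]=0$ for every function $g:\mathbb{R}\to\mathbb{R}$ such that $g$ and $g'$ are locally absolutely continuous and $\mathbb{E}|g'(W)|<\infty$, $\mathbb{E}|g''(W)|<\infty$. (ii) Conversely, if $X$ is any real-valued random variable such that $\mathbb{E}[(\mathcal{A}g)(X)]=0$ for every twice-differentiable function $g:\mathbb{R}\to\mathbb{R}$ with $\|g\|_{\infty},\|g'\|_{\infty},\|g''\|_{\infty}<\infty$, then $X\sim\mathrm{Laplace}(0,b)$.
   Context: For $a\in\mathbb{R}$, $b>0$, $\mathrm{Laplace}(a,b)$ denotes the probability distribution on $\mathbb{R}$ with density $w\mapsto\frac{1}{2b}e^{-|w-a|/b}$. $\|\cdot\|_\infty$ denotes the supremum norm on $\mathbb{R}$. When $g'$ is only locally absolutely continuous, $g''$ is its almost-everywhere defined derivative. *)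

(* Defs.v *)
From HB Require Import structures.
From mathcomp Require Import all_boot all_order all_algebra.
From mathcomp Require Import all_classical all_reals all_analysis.

Set Implicit Arguments.
Unset Strict Implicit.
Unset Printing Implicit Defensive.

Import Order.TTheory GRing.Theory Num.Theory.
Import numFieldNormedType.Exports.

Local Open Scope classical_set_scope.
Local Open Scope ring_scope.

Definition laplace_pdf {R : realType} (a b w : R) : R :=
  (2 * b)^-1 * expR (- `|w - a| / b).

Definition laplace_prob {R : realType} (a b : R) (A : set R) : \bar R :=
  (\int[lebesgue_measure]_(w in A) (laplace_pdf a b w)%:E)%E.

Definition laplace_distributed {R : realType} (a b : R)
    {d : measure_display} {T : measurableType d} {P : probability T R}
    (X : {RV P >-> R}) : Prop :=
  forall A : set R, measurable A -> distribution P X A = laplace_prob a b A.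

Definition sup_norm {R : realType} (f : R -> R) : \bar R :=
  ereal_sup (range (fun x => `|f x|%:E)).

Definition absolutely_continuous_on {R : realType} (a b : R) (f : R -> R) :
    Prop :=
  forall e : R, 0 < e -> exists2 delta : R, 0 < delta &
    forall (n : nat) (l r : 'I_n -> R),
      (forall i, [/\ a <= l i, l i <= r i & r i <= b]) ->
      trivIset setT (fun i => `]l i, r i[%classic) ->
      \sum_(i < n) (r i - l i) < delta ->
      \sum_(i < n) `|f (r i) - f (l i)| < e.

Definition locally_absolutely_continuous {R : realType} (f : R -> R) : Prop :=
  forall a b : R, a <= b -> absolutely_continuous_on a b f.

Definition twice_differentiable {R : realType} (f : R -> R) : Prop :=
  forall x : R, derivable f x 1 /\ derivable f^`()%classic x 1.

(* [derive1] is total: at points where the derivative does not exist it takes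
   the value 0.  When f^`() is locally absolutely continuous, f^`(2) is thus a
   Borel version of the almost-everywhere defined second derivative. *)
Definition laplace_operator {R : realType} (b : R) (f : R -> R) (x : R) : R :=
  f x - f 0 - b ^+ 2 * f^`(2)%classic x.

(* Main.v *)
Require Import Defs.
From HB Require Import structures.
From mathcomp Require Import all_boot all_order all_algebra.
From mathcomp Require Import all_classical all_reals all_analysis.
From mathcomp Require Import measurable_realfun.
From mathcomp Require Import ring lra.

Import Order.TTheory GRing.Theory Num.Theory.
Import numFieldNormedType.Exports.

Local Open Scope classical_set_scope.
Local Open Scope ring_scope.

Set Implicit Arguments.
Unset Strict Implicit.
Unset Printing Implicit Defensive.

(** Write p for the density of Laplace(0, b) and A for the operator
    f |-> f - f(0) - b^2 f''.

    The direct part rests on one feature of p: on the positive half-line its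
    tail is proportional to itself, the integral of p over [t, +oo[ being
    b p(t).  If H is the primitive of u that vanishes at 0, exchanging the
    order of integration turns the integral of H p over [0, +oo[ into b times
    the integral of u p ([half_line_fubini]).  Using this for u = g' and then
    for u = g'' shows that the half-line [0, +oo[ contributes
    b^2 g'(0) p(0) to E[(A g)(W)] ([half_line_stein]).  The other half-line
    contributes the opposite amount, because the reflection x |-> - x
    preserves p and changes the sign of g' ([lebesgue_stein]).

    This uses g(y) - g(x) = integral of g' over [x, y], and the same for g',
    which is the fundamental theorem of calculus for absolutely continuous
    functions ([integrable_derive1]).  Its proof: sums of total variations of
    an absolutely continuous f over disjoint intervals are small when the
    total length is small ([total_variation_sum_le]), so f is a difference of
    two nondecreasing absolutely continuous functions.  The Lebesgue-Stieltjes
    measure of such a function is absolutely continuous with respect to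
    Lebesgue measure ([lebesgue_stieltjes_dominates]); its Radon-Nikodym
    derivative h satisfies f(y) - f(x) = integral of h over ]x, y], and the
    Lebesgue differentiation theorem identifies h with f' almost everywhere.
    As f' is Borel ([measurable_derive1]), h may be replaced by f'.

    For the converse, p is the Green function of 1 - b^2 D^2: when h is
    continuous with compact support, f = p convolved with h solves
    f - b^2 f'' = h, is bounded together with f' and f'', and f(0) is the
    integral of h p.  The hypothesis on X for this f therefore says that
    E[h(X)] is the integral of h p ([resolvent_expectation]).  Letting h
    increase to the indicator of an open interval, the law of X and the
    Laplace law agree on open intervals, hence on all Borel sets. *)

(** * Variation of an absolutely continuous function *)

Section disjoint_intervals.
Context {R : realType}.
Implicit Types (a b x y : R) (p q : R * R) (s t : seq (R * R)) (f : R -> R).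

(** A comparison of endpoints rather than an emptiness statement: it is
    decidable, so that it can be used with [pairwise], and it is preserved by
    monotone maps. *)
Definition apart p q : bool := (p.2 <= q.1) || (q.2 <= p.1).

Definition nonoverlapping a b s : bool :=
  all (fun p => (a <= p.1 <= p.2) && (p.2 <= b)) s && pairwise apart s.

Definition total_length s : R := \sum_(p <- s) (p.2 - p.1).

Definition total_increment f s : R := \sum_(p <- s) `|f p.2 - f p.1|.

Lemma apart_disjoint p q :
  apart p q -> `]p.1, p.2[%classic `&` `]q.1, q.2[%classic = set0.
Proof.
move=> pq; rewrite -subset0 => x [] /=; rewrite !in_itv/= => /andP[px xp].
move=> /andP[qx xq]; case/orP: pq => [pq|qp].
  by move: (lt_trans xp (le_lt_trans pq qx)); rewrite ltxx.
by move: (lt_trans xq (le_lt_trans qp px)); rewrite ltxx.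
Qed.

(** Families of intervals are lists from here on, because cutting one interval
    of a family into pieces is then a concatenation. *)
Lemma absolutely_continuous_seq a b f (e : R) :
  absolutely_continuous_on a b f -> 0 < e ->
  exists2 delta : R, 0 < delta & forall s, nonoverlapping a b s ->
    total_length s < delta -> total_increment f s < e.
Proof.
move=> acf e0; have [delta delta0 H] := acf e e0.
exists delta => // s /andP[/allP/= sab /(pairwiseP (0, 0)) sep] ss.
have mem (i : 'I_(size s)) : nth (0, 0) s i \in s by exact: mem_nth.
have := H (size s) (fun i => (nth (0, 0) s i).1) (fun i => (nth (0, 0) s i).2).
rewrite /total_increment (big_nth (0, 0)) big_mkord; apply.
- by move=> i; have /andP[/andP[]] := sab _ (mem i).
- apply/trivIsetP => i j _ _ /eqP/eqP ij; have [ltij|ltji] : (i < j)%N \/ (j < i)%N.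
    by apply/orP; rewrite -neq_ltn.
  + by apply/apart_disjoint/sep; rewrite ?inE.
  + by rewrite setIC; apply/apart_disjoint/sep; rewrite ?inE.
- by move: ss; rewrite /total_length (big_nth (0, 0)) big_mkord.
Qed.

(** The order of the arguments of [zip] makes the variation along [l] a sum
    over this list. *)
Definition gaps x (l : seq R) : seq (R * R) :=
  [seq (p.2, p.1) | p <- zip l (x :: l)].

Lemma gaps_cons x y l : gaps x (y :: l) = (x, y) :: gaps y l.
Proof. by []. Qed.

Lemma variation_gaps x y f l : itv_partition x y l ->
  variation x y f l = total_increment f (gaps x l).
Proof. by move=> xyl; rewrite variation_zip// /total_increment big_map. Qed.

Lemma gaps_within x l : path <%O x l ->
  all (fun p => (x <= p.1 <= p.2) && (p.2 <= last x l)) (gaps x l).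
Proof.
elim: l x => // y l ih x /= /andP[xy yl]; rewrite lexx (ltW xy)/=.
have ll : y <= last y l by exact: (itv_partition_le (conj yl (eqxx _))).
rewrite ll/=; apply: sub_all (ih _ yl) => p /=.
by move=> /andP[/andP[yp ->] ->]; rewrite (le_trans (ltW xy) yp).
Qed.

Lemma pairwise_gaps x l : path <%O x l -> pairwise apart (gaps x l).
Proof.
elim: l x => // y l ih x /andP[xy yl]; rewrite gaps_cons pairwise_cons ih// andbT.
apply: sub_all (gaps_within yl) => p /andP[/andP[yp _] _].
by rewrite /apart/= yp.
Qed.

Lemma total_length_gaps x l : total_length (gaps x l) = last x l - x.
Proof.
elim: l x => [|y l ih] x; first by rewrite /total_length big_nil subrr.
by rewrite gaps_cons /total_length big_cons/= -/(total_length _) ih; ring.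
Qed.

Lemma apart_gaps x l p : path <%O x l -> apart (x, last x l) p ->
  all (apart^~ p) (gaps x l).
Proof.
move=> xl xp; apply: sub_all (gaps_within xl) => q.
move=> /andP[/andP[xq _] ql]; move: xp; rewrite /apart/=.
by case/orP=> [lp|px]; [rewrite (le_trans ql lp)|rewrite (le_trans px xq) orbT].
Qed.

Lemma nonoverlapping_catCA a b s t u :
  nonoverlapping a b (s ++ t ++ u) = nonoverlapping a b (t ++ s ++ u).
Proof.
have apartC p q : apart p q = apart q p by rewrite /apart orbC.
have st : allrel apart s t = allrel apart t s.
  by rewrite allrelC; apply: eq_allrel => p q; exact: apartC.
rewrite /nonoverlapping !all_cat !pairwise_cat !allrel_catr st.
rewrite [X in X && _ = _]andbCA; congr (_ && _).
by case: (allrel apart t s); case: (allrel apart s u); case: (allrel apart t u);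
  rewrite ?andbF//= andbCA.
Qed.

(** Cutting an interval along a partition changes neither the disjointness nor
    the total length of a family, so the delta of absolute continuity survives
    the passage from increments to variations. *)
Lemma nonoverlapping_refine a b x y l s : itv_partition x y l ->
  nonoverlapping a b ((x, y) :: s) ->
  nonoverlapping a b (gaps x l ++ s) /\
  total_length (gaps x l ++ s) = total_length ((x, y) :: s).
Proof.
move=> [xl /eqP ly] /andP[/= /andP[/andP[/andP[ax xy] yb] sab] /andP[xys ss]].
split; last first.
  by rewrite /total_length big_cat/= -/(total_length _) total_length_gaps big_cons ly.
rewrite /nonoverlapping all_cat sab pairwise_cat ss pairwise_gaps// !andbT.
apply/andP; split.
  apply: sub_all (gaps_within xl) => p; rewrite ly => /andP[/andP[xp ->] py].
  by rewrite (le_trans ax xp) (le_trans py yb).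
apply/allrelP => p q /[swap] qs; move: p; apply/allP/apart_gaps => //.
by rewrite ly; apply: (allP xys).
Qed.

(** Replace the intervals of the family, one at a time, by arbitrary partitions
    of them.  Each replacement gives a family as small as before, so the bound
    on increments still applies, and the supremum over the partitions of one
    interval can be taken while the rest of the family is held fixed. *)
Lemma total_variation_sum_le f (a b c M : R) :
  (forall s, nonoverlapping a b s -> total_length s < c ->
     total_increment f s <= M) ->
  forall s, nonoverlapping a b s -> total_length s < c ->
    (\sum_(p <- s) total_variation p.1 p.2 f <= M%:E)%E.
Proof.
move=> H s sab sc; suff : forall t, nonoverlapping a b (s ++ t) ->
    total_length (s ++ t) < c ->
    (\sum_(p <- s) total_variation p.1 p.2 f + (total_increment f t)%:E <= M%:E)%E.
  move=> /(_ [::]); rewrite cats0 /total_increment big_nil adde0; exact.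
(* [t] collects the pieces of the intervals that are already cut *)
elim: s {sab sc} => [|[x y] s ih] t sab sc.
  by rewrite big_nil add0e lee_fin; exact: H.
have xy : x <= y by move: sab => /andP[/= /andP[/andP[/andP[]]]].
rewrite big_cons/=.
set S := (\sum_(p <- s) _)%E; set T := total_increment f t.
have S0 : (0 <= S)%E.
  rewrite /S big_seq_cond; apply: sume_ge0 => -[u v]; rewrite andbT => uvs.
  apply: total_variation_ge0; move: sab => /andP[/allP/(_ (u, v))].
  by rewrite /= inE mem_cat uvs orbT => /(_ isT) /andP[/andP[]].
have key l : itv_partition x y l -> ((variation x y f l)%:E + S + T%:E <= M%:E)%E.
  move=> xyl; have [r1 r2] := nonoverlapping_refine xyl sab.
  have [n1 n2] : nonoverlapping a b (s ++ gaps x l ++ t) /\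
      total_length (s ++ gaps x l ++ t) = total_length (gaps x l ++ s ++ t).
    rewrite nonoverlapping_catCA; split=> //.
    by rewrite /total_length; apply: perm_big; rewrite perm_catCA.
  have := ih (gaps x l ++ t) n1; rewrite n2 r2 => /(_ sc).
  rewrite /total_increment big_cat/= -!/(total_increment _ _) -/S -/T.
  by rewrite -(variation_gaps _ xyl) EFinD addeCA addeA.
have stab : nonoverlapping a b (s ++ t).
  by move: sab => /andP[/= /andP[_ h1] /andP[_ h2]]; apply/andP.
have ST : (S + T%:E <= M%:E)%E.
  apply: ih => //; apply: le_lt_trans sc.
  by rewrite /total_length/= big_cons/= lerDr subr_ge0.
have Sfin : S \is a fin_num.
  rewrite ge0_fin_numE//; apply: le_lt_trans (ltry M).
  apply: le_trans ST; rewrite leeDl// lee_fin /T /total_increment.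
  by apply: sumr_ge0.
rewrite -addeA -leeBrDr; last by rewrite fin_numD Sfin.
apply: ge_ereal_sup => _ [_ [l xyl <-] <-].
by rewrite leeBrDr ?addeA ?key// fin_numD Sfin.
Qed.

(** With the delta that goes with 1, the variation over a step shorter than
    delta is at most 1, and finitely many such steps cover [x, y]. *)
Lemma total_variation_fin a b f x y : absolutely_continuous_on a b f ->
  a <= x -> x <= y -> y <= b -> total_variation x y f \is a fin_num.
Proof.
move=> acf ax xy yb; have [d d0 H] := absolutely_continuous_seq acf ltr01.
have small u v : a <= u -> u <= v -> v <= b -> v - u < d ->
    total_variation u v f \is a fin_num.
  move=> au uv vb uvd; rewrite ge0_fin_numE ?total_variation_ge0//.
  have := @total_variation_sum_le f a b d 1 _ [:: (u, v)].
  rewrite /nonoverlapping/= au uv vb /total_length !big_seq1 => K.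
  apply: (@le_lt_trans _ _ 1%E); last exact: ltry.
  by apply: K => // s sab sd; apply/ltW/H.
(* half of d, because the steps must be strictly shorter than d *)
have main n : forall u, x <= u -> u <= y -> u - x <= n%:R * (d / 2) ->
    total_variation x u f \is a fin_num.
  elim: n => [|n ih] u xu uy un.
    have -> : u = x by apply/le_anti; rewrite xu andbT -subr_le0 (le_trans un)// mul0r.
    by rewrite total_variationxx.
  have [xd|dx] := leP (u - x) (d / 2).
    apply: small => //; first exact: le_trans yb.
    by apply: le_lt_trans xd _; lra.
  have w1 : x <= u - d / 2 by lra.
  have w2 : u - d / 2 <= u by lra.
  rewrite (total_variationD f w1 w2) fin_numD; apply/andP; split.
    apply: ih => //; first by lra.
    by move: un; rewrite -natr1 mulrDl mul1r; lra.
  apply: small => //; [exact: le_trans w1|exact: le_trans yb|lra].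
apply: (main (Num.truncn ((y - x) / (d / 2))).+1) => //.
rewrite -ler_pdivrMr ?divr_gt0//; apply/ltW/truncnS_gt.
Qed.

End disjoint_intervals.

(** * Stieltjes measures of absolutely continuous functions *)

Section lebesgue_stieltjes_density.
Context {R : realType}.
Local Notation mu := (@lebesgue_measure R).
Implicit Types (a b x y : R) (s : seq (R * R)).

Lemma open_interval_itvoo (X : set R) : open X -> is_interval X -> X !=set0 ->
  (mu X < +oo)%E -> exists l r, l < r /\ X = `]l, r[%classic.
Proof.
move=> oX iX [x Xx] Xoo.
have [lX uX] : has_lbound X /\ has_ubound X.
  move/is_intervalP : (iX) => XI; case: (Rhull X) XI => [[bi i|[]] [bj j|[]]] XI;
    move: Xoo Xx; rewrite {}XI lebesgue_measure_itv/= ?set_itvE//.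
  - by rewrite in_itv/= andbF.
  - by rewrite ltry.
  - by rewrite ltNyr.
have XE : X = `]inf X, sup X[%classic.
  rewrite -[LHS]((interior_id X).1 oX); apply/seteqP; split=> y.
    by rewrite (interval_bounded_interior iX lX uX) /= in_itv.
  by rewrite (interval_bounded_interior iX lX uX) /= in_itv.
exists (inf X), (sup X); split=> //.
have : `]inf X, sup X[%classic x by rewrite -XE.
by rewrite /= in_itv/= => /andP[]; exact: lt_trans.
Qed.

Lemma disjoint_apart (p q : R * R) : p.1 < p.2 -> q.1 < q.2 ->
  `]p.1, p.2[%classic `&` `]q.1, q.2[%classic = set0 -> apart p q.
Proof.
case: p q => [l r] [l' r'] /= lr lr' pq; apply: contrapT => /negP.
rewrite /apart/= negb_or -!ltNge => /andP[l'r lr''].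
have : set0 ((Num.max l l' + Num.min r r') / 2).
  rewrite -pq /= !in_itv/=.
  have : Num.max l l' < Num.min r r' by rewrite gt_max !lt_min lr lr' l'r lr''.
  have : l <= Num.max l l' by rewrite le_max lexx.
  have : l' <= Num.max l l' by rewrite le_max lexx orbT.
  have : Num.min r r' <= r by rewrite ge_min lexx.
  have : Num.min r r' <= r' by rewrite ge_min lexx orbT.
  by move=> *; split; apply/andP; split; lra.
by [].
Qed.

(** Absolute continuity with one delta for the whole line.  It is what a
    function frozen outside of a compact interval satisfies, and a measure on
    the whole line can be attached to such a function. *)
Definition uniformly_absolutely_continuous (F : R -> R) : Prop :=
  forall e : R, 0 < e -> exists2 delta : R, 0 < delta & forall s,
    all (fun p => p.1 <= p.2) s -> pairwise apart s ->
    total_length s < delta -> total_increment F s <= e.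

Lemma lebesgue_stieltjes_itvoc (F : cumulative R R) x y : x <= y ->
  lebesgue_stieltjes_measure F `]x, y]%classic = (F y - F x)%:E.
Proof.
move=> xy; rewrite /lebesgue_stieltjes_measure /measure_extension.
rewrite measurable_mu_extE/=; last exact: is_ocitv.
exact: wlength_itv_bnd.
Qed.

(** A Lebesgue null set lies in an open set of measure less than delta.  The
    components of this open set are disjoint intervals of total length less
    than delta, so [F] grows by at most [e] along finitely many of them, and
    hence along all of them; [e] is arbitrary. *)
Lemma lebesgue_stieltjes_dominates (F : cumulative R R) :
  uniformly_absolutely_continuous F ->
  lebesgue_stieltjes_measure F `<< mu.
Proof.
move=> acF; apply/null_content_dominatesP => A mA A0.
apply/eqP; rewrite eq_le measure_ge0 andbT.
apply/lee_addgt0Pr => e e0; rewrite add0e.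
have [d d0 Fd] := acF e e0.
have Afin : (mu A < +oo)%E by rewrite A0 ltry.
have [U [oU AU UAd]] := lebesgue_regularity_outer mA Afin d0.
have mU : measurable (U : set (measurableTypeR R)) by exact: open_measurable.
have Ud : (mu U < d%:E)%E.
  rewrite -(setDUK AU) measureU//; last 2 first.
    exact: measurableD.
    by rewrite setDE setICA setICr setI0.
  by rewrite A0 add0e.
apply: (@le_trans _ _ (lebesgue_stieltjes_measure F U)).
  by apply: le_measure => //; rewrite inE.
pose I : nat -> set (measurableTypeR R) := open_disjoint_itv oU.
have mI q : measurable (I q) 
  by apply: open_measurable; exact: open_disjoint_itv_open.
have tI : trivIset setT I  by exact: open_disjoint_itv_trivIset.
have UI : U = \bigcup_q I q  by exact: open_disjoint_itv_bigcup.
have Ioo q : (mu (I q) < +oo)%E.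
  apply: le_lt_trans (lt_trans Ud (ltry d)); apply: le_measure; rewrite ?inE//.
  by move=> x Ix; rewrite UI; exists q.
have /choice[p pP] q : exists p : R * R, I q !=set0 ->
    p.1 < p.2 /\ I q = `]p.1, p.2[%classic.
  have [Iq|Iq] := pselect (I q !=set0); last by exists (0, 0).
  have [l [r [lr IE]]] := open_interval_itvoo (@open_disjoint_itv_open _ _ oU q)
    (@open_disjoint_itv_is_interval _ _ oU q) Iq (Ioo q).
  by exists (l, r).
rewrite {1}UI measure_bigcup//.
apply: lime_le; first by apply: is_cvg_nneseries => n _ _; exact: measure_ge0.
near=> n.
(* empty components have an arbitrary interval [p q] and are discarded *)
pose s := [seq p q | q <- iota 0 n & `[< I q !=set0 >]].
have sums (m : {measure set (measurableTypeR R) -> \bar R}) :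
    (\sum_(0 <= q < n) m (I q) =
     \sum_(q <- iota 0 n | `[< I q !=set0 >]) m (I q))%E.
  rewrite /index_iota subn0 [RHS]big_mkcond/=; apply: eq_bigr => q _.
  case: ifPn => // /asboolPn /set0P/negP/negPn/eqP ->; exact: measure0.
have len : (total_length s)%:E = (\sum_(0 <= q < n) mu (I q))%E.
  rewrite (sums mu) /total_length big_map big_filter -sumEFin.
  apply: eq_bigr => q /asboolP /pP[pq ->].
  rewrite [RHS](_ : _ = lebesgue_measure `](p q).1, (p q).2[%classic)//.
  by rewrite lebesgue_measure_itv/= lte_fin pq EFinB.
have s1 : all (fun p => p.1 <= p.2) s.
  by apply/allP => _ /mapP[q + ->]; rewrite mem_filter => /andP[/asboolP/pP[/ltW]].
have s2 : pairwise apart s.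
  rewrite pairwise_map.
  apply: (@sub_in_pairwise _ (fun q => `[< I q !=set0 >])
    (fun i j => i != j)).
  - move=> i j /asboolP Ii /asboolP Ij ij /=.
    have [pi Ei] := pP _ Ii; have [pj Ej] := pP _ Ij.
    by apply: disjoint_apart => //; rewrite -Ei -Ej; move/trivIsetP : tI; apply.
  - exact: filter_all.
  - by rewrite -uniq_pairwise filter_uniq// iota_uniq.
have s3 : total_length s < d.
  rewrite -lte_fin len; apply: le_lt_trans Ud.
  rewrite [in leRHS]UI measure_bigcup//; apply: le_trans; last first.
    exact: (nneseries_lim_ge n).
  by under [X in (_ <= X)%E]eq_bigl do rewrite in_setT.
have := Fd s s1 s2 s3; rewrite -lee_fin; apply: le_trans.
under eq_bigl do rewrite in_setT.
rewrite (sums (lebesgue_stieltjes_measure F)).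
rewrite /total_increment big_map big_filter -sumEFin.
apply: lee_sum => q /asboolP /pP[pq ->].
have Fpq : F (p q).1 <= F (p q).2.
  by apply: cumulative_is_nondecreasing; exact: ltW.
rewrite ger0_norm ?subr_ge0// -lebesgue_stieltjes_itvoc ?(ltW pq)//.
by apply: le_measure; rewrite ?inE//; exact: subset_itv_oo_oc.
Unshelve. all: by end_near. Qed.

(** The Radon-Nikodym theorem, for the Stieltjes measure restricted to ]a, b]
    in order to make it finite. *)
Lemma absolutely_continuous_cumulative_density (F : cumulative R R) a b :
  uniformly_absolutely_continuous F -> a <= b ->
  exists2 h : R -> R, mu.-integrable setT (EFin \o h) &
    forall x y, a <= x -> x <= y -> y <= b ->
      (\int[mu]_(t in `]x, y]) (h t)%:E = (F y - F x)%:E)%E.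
Proof.
move=> acF ab; pose D : set (measurableTypeR R) := `]a, b]%classic.
have mD : measurable D by exact: measurable_itv.
have Doo : (lebesgue_stieltjes_measure F D < +oo)%E.
  by rewrite lebesgue_stieltjes_itvoc// ltry.
pose nu : {finite_measure set (measurableTypeR R) -> \bar R} := mfrestr mD Doo.
have numu : nu `<< mu.
  apply/null_content_dominatesP => A mA A0; rewrite /nu /= /mfrestr /mrestr.
  have /null_content_dominatesP dom := lebesgue_stieltjes_dominates acF.
  apply/eqP; rewrite eq_le measure_ge0 andbT -(dom _ mA A0).
  by apply: le_measure; rewrite ?inE//; exact: measurableI.
have [f [f0 ffin intf fE]] := radon_nikodym_sigma_finite numu.
have fh : EFin \o (fine \o f) = f by apply/funext => x /=; rewrite fineK.
exists (fine \o f); first by rewrite fh.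
move=> x y ax xy yb; under eq_integral do rewrite /= fineK//.
rewrite -fE//= /mfrestr /mrestr setIidl ?lebesgue_stieltjes_itvoc//.
by apply: subset_itv; rewrite bnd_simp.
Qed.

End lebesgue_stieltjes_density.

(** * Densities of absolutely continuous functions *)

Section absolutely_continuous_density.
Context {R : realType}.
Local Notation mu := (@lebesgue_measure R).
Implicit Types (a b x y : R) (f : R -> R).

Definition clamp a b x : R := Num.max a (Num.min b x).

Lemma clamp_in a b x : a <= b -> a <= clamp a b x <= b.
Proof. by move=> ab; rewrite /clamp le_max lexx ge_max ab ge_min lexx. Qed.

Lemma clamp_id a b x : a <= x <= b -> clamp a b x = x.
Proof. by move=> /andP[ax xb]; rewrite /clamp (min_idPr xb) (max_idPr ax). Qed.

Lemma clamp_le a b x y : x <= y -> clamp a b x <= clamp a b y.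
Proof.
move=> xy; rewrite /clamp ge_max; apply/andP; split; first by rewrite le_max lexx.
by rewrite le_max le_min !ge_min lexx/= xy !orbT.
Qed.

Lemma clamp_contract a b x y : x <= y -> clamp a b y - clamp a b x <= y - x.
Proof.
move=> xy; rewrite lerBlDr /clamp ge_max; apply/andP; split.
  by rewrite ler_wpDl ?subr_ge0// le_max lexx.
have : Num.min b x <= Num.max a (Num.min b x) by rewrite le_max lexx orbT.
suff : Num.min b y <= y - x + Num.min b x by move=> *; lra.
by have [] := leP b x; have [] := leP b y => *; lra.
Qed.

Lemma uniformly_absolutely_continuous_continuous (F : R -> R) :
  uniformly_absolutely_continuous F -> continuous F.
Proof.
move=> acF x; apply/cvgrPdist_le => e e0; have [d d0 H] := acF e e0.
suff key y z : `|y - z| < d -> `|F y - F z| <= e.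
  by near=> y; apply: key; near: y; apply: cvgr_dist_lt => //; exact: cvg_id.
wlog xy : y z / y <= z.
  move=> wl; have [/wl|/ltW /wl] := leP y z; first exact.
  by rewrite distrC [`|F _ - _|]distrC; exact.
move=> xyd; have := H [:: (y, z)]; rewrite /= xy /total_length /total_increment !big_seq1/=.
rewrite distrC; apply => //.
by apply: le_lt_trans xyd; rewrite distrC ler_norm.
Unshelve. all: by end_near. Qed.

(** Freezing [G] outside of [a, b] gives a cumulative function on the line.
    Clamping contracts lengths and preserves the order of endpoints, so
    absolute continuity is inherited. *)
Lemma nondecreasing_density (G : R -> R) a b : a <= b ->
  (forall x y, a <= x -> x <= y -> y <= b -> G x <= G y) ->
  (forall e : R, 0 < e -> exists2 delta : R, 0 < delta & forall s,
     nonoverlapping a b s -> total_length s < delta -> total_increment G s <= e) ->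
  exists2 h : R -> R, mu.-integrable setT (EFin \o h) &
    forall x y, a <= x -> x <= y -> y <= b ->
      (\int[mu]_(t in `]x, y]) (h t)%:E = (G y - G x)%:E)%E.
Proof.
move=> ab ndG acG; pose F x := G (clamp a b x).
have acF : uniformly_absolutely_continuous F.
  move=> e e0; have [d d0 H] := acG e e0; exists d => // s s1 s2 sd.
  pose t := [seq (clamp a b p.1, clamp a b p.2) | p <- s].
  have tE : total_increment F s = total_increment G t.
    by rewrite /t /total_increment big_map.
  rewrite tE; apply: H.
    apply/andP; split.
      apply/allP => _ /mapP[p ps ->] /=; have p12 := allP s1 _ ps.
      rewrite (andP (clamp_in p.1 ab)).1 (andP (clamp_in p.2 ab)).2 andbT/=.
      exact: clamp_le.
    rewrite pairwise_map; apply: sub_pairwise s2 => p q /orP[pq|qp].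
      by apply/orP; left; exact: clamp_le.
    by apply/orP; right; exact: clamp_le.
  apply: le_lt_trans sd; rewrite /total_length big_map big_seq [leRHS]big_seq.
  by apply: ler_sum => p ps; apply: clamp_contract; exact: (allP s1 _ ps).
have ndF : nondecreasing F.
  move=> x y xy; have /andP[ax _] := clamp_in x ab; have /andP[_ yb] := clamp_in y ab.
  by apply: ndG => //; exact: clamp_le.
have rcF := right_continuousW (uniformly_absolutely_continuous_continuous acF).
pose mF := isCumulative.Build R _ R F ndF rcF.
pose cF : cumulative R R := HB.pack F mF.
have [h inth hE] := @absolutely_continuous_cumulative_density R cF a b acF ab.
exists h => // x y ax xy yb; rewrite hE//= /F !clamp_id ?ax ?yb//.
  by rewrite (le_trans xy yb).
by rewrite (le_trans ax xy).
Qed.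

(** Let V be the total variation from [a].  In f = V - (V - f) both terms are
    nondecreasing, and their increments are at most twice those of V, which
    are small by [total_variation_sum_le]. *)
Lemma absolutely_continuous_density f a b :
  absolutely_continuous_on a b f -> a <= b ->
  exists2 h : R -> R, mu.-integrable setT (EFin \o h) &
    forall x y, a <= x -> x <= y -> y <= b ->
      (\int[mu]_(t in `]x, y]) (h t)%:E = (f y - f x)%:E)%E.
Proof.
move=> acf ab; pose V x := fine (total_variation a x f).
have TVfin x y : a <= x -> x <= y -> y <= b -> total_variation x y f \is a fin_num.
  exact: total_variation_fin.
have VE x y : a <= x -> x <= y -> y <= b ->
    V y - V x = fine (total_variation x y f).
  move=> ax xy yb; rewrite /V (total_variationD f ax xy) fineD ?TVfin//.
    by rewrite addrAC subrr add0r.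
  exact: le_trans yb.
have fV x y : a <= x -> x <= y -> y <= b -> `|f y - f x| <= V y - V x.
  move=> ax xy yb; rewrite VE// -lee_fin fineK ?TVfin//.
  exact: total_variation_ge.
have acV e : 0 < e -> exists2 delta : R, 0 < delta & forall s,
     nonoverlapping a b s -> total_length s < delta ->
     \sum_(p <- s) (V p.2 - V p.1) <= e.
  move=> e0; have [d d0 H] := absolutely_continuous_seq acf e0.
  exists d => // s sab sd; rewrite -lee_fin.
  have := @total_variation_sum_le _ f a b d e (fun s sab sd => ltW (H s sab sd)) s sab sd.
  apply: le_trans; rewrite -sumEFin big_seq [leRHS]big_seq; apply: lee_sum => p ps.
  have /andP[/allP/(_ _ ps)/andP[/andP[ap pp] pb] _] := sab.
  by rewrite VE// fineK// TVfin.
have inc (s : seq (R * R)) (G : R -> R) : nonoverlapping a b s ->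
    (forall x y, a <= x -> x <= y -> y <= b -> `|G y - G x| <= (V y - V x) * 2) ->
    total_increment G s <= \sum_(p <- s) (V p.2 - V p.1) * 2.
  move=> sab GV; rewrite /total_increment big_seq [leRHS]big_seq.
  apply: ler_sum => p ps.
  have /andP[/allP/(_ _ ps)/andP[/andP[ap pp] pb] _] := sab.
  exact: GV.
have dens (G : R -> R) :
    (forall x y, a <= x -> x <= y -> y <= b -> 0 <= G y - G x <= (V y - V x) * 2) ->
    exists2 h : R -> R, mu.-integrable setT (EFin \o h) &
    forall x y, a <= x -> x <= y -> y <= b ->
      (\int[mu]_(t in `]x, y]) (h t)%:E = (G y - G x)%:E)%E.
  move=> GV; apply: nondecreasing_density => // [x y ax xy yb|e e0].
    by rewrite -subr_ge0; case/andP: (GV x y ax xy yb).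
  have [d d0 H] := acV (e / 2) (divr_gt0 e0 (ltr0Sn _ _)); exists d => // s sab sd.
  apply: le_trans (inc s G sab _) _.
    by move=> x y ax xy yb; have /andP[G0 ?] := GV x y ax xy yb; rewrite ger0_norm.
  by rewrite -mulr_suml -ler_pdivlMr// H.
have [h1 ih1 h1E] : exists2 h : R -> R, mu.-integrable setT (EFin \o h) &
    forall x y, a <= x -> x <= y -> y <= b ->
      (\int[mu]_(t in `]x, y]) (h t)%:E = (V y - V x)%:E)%E.
  apply: dens => x y ax xy yb; have := fV x y ax xy yb.
  by have := normr_ge0 (f y - f x) => ? ?; apply/andP; split; lra.
have [h2 ih2 h2E] : exists2 h : R -> R, mu.-integrable setT (EFin \o h) &
    forall x y, a <= x -> x <= y -> y <= b ->
      (\int[mu]_(t in `]x, y]) (h t)%:E = ((V y - f y) - (V x - f x))%:E)%E.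
  apply: (dens (fun x => V x - f x)) => x y ax xy yb.
  by have := fV x y ax xy yb; rewrite ler_norml => /andP[? ?]; apply/andP; split; lra.
exists (h1 \- h2).
  by rewrite (_ : EFin \o _ = (EFin \o h1) \- (EFin \o h2))%E//; exact: integrableB.
move=> x y ax xy yb.
under eq_integral do rewrite EFinB.
rewrite integralB//=; [|exact: integrableS ih1|exact: integrableS ih2].
by rewrite h1E// h2E// -EFinB/=; congr EFin; lra.
Qed.

End absolutely_continuous_density.

(** * The fundamental theorem of calculus *)

Section fundamental_theorem.
Context {R : realType}.
Local Notation mu := (@lebesgue_measure R).
Implicit Types (a b x y : R) (f : R -> R).

Definition slope f (h x : R) : R := h^-1 * (f (h + x) - f x).

(** A Cauchy criterion for difference quotients at scales below [d]; for fixed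
    [e] and [d] it is a closed condition on [x]. *)
Definition slope_oscillation f (e d : R) : set R :=
  [set x | forall r s : R, r != 0 -> s != 0 -> `|r| < d -> `|s| < d ->
     `|slope f r x - slope f s x| <= e].

Lemma continuous_slope f h : continuous f -> continuous (slope f h).
Proof.
move=> cf x; apply: cvgM; first exact: cvg_cst.
apply: cvgB; last exact: cf.
apply: continuous_comp; last exact: cf.
by apply: cvgD; [exact: cvg_cst|exact: cvg_id].
Qed.

(** An arbitrary intersection of closed sets is closed, so all real scales can
    be quantified over without passing to a countable set of them. *)
Lemma closed_slope_oscillation f e d : continuous f ->
  closed (slope_oscillation f e d).
Proof.
move=> cf; pose I := [set p : R * R | [/\ p.1 != 0, p.2 != 0, `|p.1| < d & `|p.2| < d]].
rewrite (_ : slope_oscillation f e d =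
    \bigcap_(p in I) [set x | `|slope f p.1 x - slope f p.2 x| <= e]); last first.
  apply/seteqP; split=> [x xe [r s] [/= *]|x xe r s *]; first exact: xe.
  exact: (xe (r, s)).
apply: closed_bigI => p _.
have cg : continuous (fun x => `|slope f p.1 x - slope f p.2 x|).
  by move=> x; apply: cvg_norm; apply: cvgB; exact: continuous_slope.
have := (continuous_closedP _).1 cg [set y | y <= e]; apply; exact: closed_le.
Qed.

Lemma slope_cvgP f x : cvg (slope f ^~ x @ 0^') <->
  (forall n, exists m, slope_oscillation f n.+1%:R^-1 m.+1%:R^-1 x).
Proof.
split=> [/cvg_ex[/= l /cvgrPdist_lt fl] n|H].
  have n0 : 0 < (n.+1%:R^-1 / 2 : R) by rewrite divr_gt0// invr_gt0.
  have [d /= d0 fd] := fl _ n0.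
  have [m md] : exists m, (m.+1%:R^-1 : R) < d.
    by have [m] := ltr_add_invr d0; rewrite add0r; exists m.
  exists m => r s r0 s0 rm sm.
  have rd : `|l - slope f r x| < n.+1%:R^-1 / 2.
    by apply: fd => //; rewrite /ball_/= sub0r normrN (lt_trans rm).
  have sd : `|l - slope f s x| < n.+1%:R^-1 / 2.
    by apply: fd => //; rewrite /ball_/= sub0r normrN (lt_trans sm).
  rewrite (_ : _ - _ = (l - slope f s x) - (l - slope f r x)); last by ring.
  rewrite (le_trans (ler_normB _ _))// [leRHS]splitr lerD ?ltW//.
apply/cauchy_cvgP/cauchy_exP => e e0.
have [n ne] : exists n, (n.+1%:R^-1 : R) < e.
  by have [n] := ltr_add_invr e0; rewrite add0r; exists n.
have [m mx] := H n; have m0 : 0 < (m.+1%:R^-1 : R) by rewrite invr_gt0.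
(* any scale below 1/(m+1) would do *)
exists (slope f (m.+1%:R^-1 / 2) x); exists m.+1%:R^-1 => //= h.
rewrite /ball_/= sub0r normrN => hm h0.
apply: le_lt_trans ne; apply: mx => //.
by rewrite gtr0_norm ?divr_gt0// ltr_pdivrMr// ltr_pMr// ltr1n.
Qed.

(** The set where the slopes converge is a countable combination of closed
    sets.  On it the derivative is the limit of the slopes at scales 1/(n+1);
    elsewhere it is the default value 0. *)
Lemma measurable_derive1 f : continuous f -> measurable_fun setT f^`()%classic.
Proof.
move=> cf; pose D := [set x : R | cvg (slope f ^~ x @ 0^')].
have mD : measurable D.
  rewrite (_ : D = \bigcap_n \bigcup_m slope_oscillation f n.+1%:R^-1 m.+1%:R^-1).
    apply: bigcapT_measurable => n; apply: bigcupT_measurable => m.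
    by apply: closed_measurable; exact: closed_slope_oscillation.
  apply/seteqP; split=> x.
    by move=> /slope_cvgP H n _; have [m] := H n; exists m.
  by move=> H; apply/slope_cvgP => n; have [m _] := H n I; exists m.
rewrite -(setvU D); apply/measurable_funU => //; first exact: measurableC.
split.
  apply: (@eq_measurable_fun _ _ R R _ (cst (0 : R))); last exact: measurable_cst.
  by move=> x; rewrite inE => Dx; rewrite /derive1 dvgP.
apply: (@measurable_fun_cvg _ R R D (fun n => slope f n.+1%:R^-1)).
  move=> n; apply: measurable_funTS; apply: continuous_measurable_fun.
  exact: continuous_slope.
move=> x Dx.
have /cvgr_dnbhsP := Dx : slope f ^~ x @ 0^' --> f^`()%classic x.
apply; split; last exact: cvg_harmonic.
by move=> n; rewrite gt_eqF// invr_gt0.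
Qed.

Lemma absolutely_continuous_continuous f :
  locally_absolutely_continuous f -> continuous f.
Proof.
move=> acf x; apply/cvgrPdist_lt => e e0.
have ab : x - 1 <= x + 1 by lra.
have [d d0 H] := absolutely_continuous_seq (acf _ _ ab) e0.
have md0 : 0 < Num.min 1 d by rewrite lt_min ltr01.
near=> y.
have xy1 : `|x - y| < Num.min 1 d.
  by near: y; apply: cvgr_dist_lt => //; exact: cvg_id.
move: xy1; rewrite lt_min => /andP[xy1 xyd].
have {xy1} /andP[y1 y2] : -1 < x - y < 1 by rewrite -ltr_norml.
have [xy|/ltW yx] := leP x y.
  have := H [:: (x, y)]; rewrite /nonoverlapping /= xy /total_length /total_increment !big_seq1/=.
  rewrite distrC andbT; apply => //; first by apply/andP; split; [apply/andP; split|]; lra.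
  by apply: le_lt_trans xyd; rewrite distrC ler_norm.
have := H [:: (y, x)]; rewrite /nonoverlapping /= yx /total_length /total_increment !big_seq1/=.
rewrite andbT; apply => //; first by apply/andP; split; [apply/andP; split|]; lra.
by apply: le_lt_trans xyd; rewrite ler_norm.
Unshelve. all: by end_near. Qed.

(** At a Lebesgue point of [h] the indefinite integral of [h] has derivative
    [h x], and [f] differs from that integral by the constant [f a]. *)
Lemma absolutely_continuous_derive1_ae f a b (h : R -> R) : a <= b ->
  mu.-integrable setT (EFin \o h) ->
  (forall x y, a <= x -> x <= y -> y <= b ->
      (\int[mu]_(t in `]x, y]) (h t)%:E = (f y - f x)%:E)%E) ->
  {ae mu, forall x, a < x < b -> f^`()%classic x = h x}.
Proof.
move=> ab ih hE.
have := lebesgue_differentiation (open_integrable_locally openT ih).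
apply: filterS; first exact: (ae_filter_ringOfSetsType mu).
move=> x lx /andP[ax xb].
have ih' u : mu.-integrable [set` Interval (BRight a) (BRight u)] (EFin \o h).
  exact: integrableS ih.
have [dF F'] := FTC1_lebesgue_pt xb (ih' b) ax lx.
rewrite -F' !derive1E; set F := fun _ => _ in dF F' *.
have FE : \forall y \near x, f y = F y + f a.
  near=> y; rewrite /F /Rintegral hE ?lexx//= ?subrK//.
    by apply/ltW; near: y; exact: lt_nbhsr.
  by apply/ltW; near: y; exact: lt_nbhsl.
rewrite (near_eq_derive _ FE) -[RHS]addr0 -(derive_cst (f a) x (1 : R)).
exact: (deriveD dF (derivable_cst _ _ _)).
Unshelve. all: by end_near. Qed.

(** The derivative and the density are Borel functions that agree almost
    everywhere, so integrability and the value of the integral carry over from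
    the density. *)
Lemma integrable_derive1 f a b : locally_absolutely_continuous f -> a <= b ->
  mu.-integrable `[a, b] (EFin \o f^`()%classic) /\
  (\int[mu]_(x in `[a, b]) (f^`()%classic x)%:E = (f b - f a)%:E)%E.
Proof.
move=> acf ab; have [h ih hE] := absolutely_continuous_density (acf a b ab) ab.
have mf : measurable_fun setT f^`()%classic.
  by apply: measurable_derive1; exact: absolutely_continuous_continuous.
have mh : measurable_fun setT h by apply/measurable_EFinP; exact: measurable_int ih.
have fh : ae_eq mu `]a, b[%classic (EFin \o f^`()%classic) (EFin \o h).
  have := absolutely_continuous_derive1_ae ab ih hE.
  apply: filterS; first exact: (ae_filter_ringOfSetsType mu).
  move=> x fh.
  by rewrite /= in_itv/= => /fh ->.
have ihoo : mu.-integrable `]a, b[ (EFin \o h) by exact: integrableS ih.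
have ifoo : mu.-integrable `]a, b[ (EFin \o f^`()%classic).
  apply/integrableP; split; first by apply/measurable_EFinP; exact: measurable_funTS.
  case/integrableP : ihoo => _; congr (_ < _)%E; apply: ae_eq_integral => //.
  - by apply: measurableT_comp => //; apply/measurable_EFinP; exact: measurable_funTS.
  - by apply: measurableT_comp => //; apply/measurable_EFinP; exact: measurable_funTS.
  - exact/ae_eq_abse/ae_eq_sym.
split.
  apply/integrableP; split; first by apply/measurable_EFinP; exact: measurable_funTS.
  rewrite integral_itv_bndoo; first by case/integrableP : ifoo.
  by apply: measurableT_comp => //; apply/measurable_EFinP; exact: measurable_funTS.
rewrite integral_itv_bndoo; last by apply/measurable_EFinP; exact: measurable_funTS.
transitivity (\int[mu]_(x in `]a, b[) (h x)%:E)%E.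
  by apply: ae_eq_integral => //; apply/measurable_EFinP; exact: measurable_funTS.
rewrite -hE// [RHS]integral_itv_bndoo//.
by apply/measurable_EFinP; exact: measurable_funTS.
Qed.

End fundamental_theorem.

(** * Integration against the Laplace density on a half-line *)

Section real_line_split.
Context {R : realType}.

Lemma setT_split (x : R) :
  [set: measurableTypeR R] = `]-oo, x]%classic `|` `]x, +oo[%classic.
Proof.
apply/seteqP; split=> // t _; rewrite /= !in_itv/= andbT.
by have [tx|tx] := leP t x; [left|right].
Qed.

Lemma disjoint_split (x : R) :
  [disjoint (`]-oo, x]%classic : set (measurableTypeR R)) & `]x, +oo[%classic].
Proof.
apply/disj_setPS => t [] /=; rewrite !in_itv/= andbT => tx /lt_le_trans /(_ tx).
by rewrite ltxx.
Qed.

End real_line_split.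

Section half_line.
Context {R : realType}.
Local Notation mu := (@lebesgue_measure R).
Variable b : R.
Hypothesis b_gt0 : 0 < b.
Local Notation p := (laplace_pdf 0 b).

Lemma laplace_pdf_ge0 x : 0 <= p x.
Proof. by rewrite mulr_ge0 ?expR_ge0// invr_ge0 mulr_ge0// ltW. Qed.

Lemma laplace_pdf_even x : p (- x) = p x.
Proof. by rewrite /laplace_pdf !subr0 normrN. Qed.

Lemma continuous_laplace_pdf : continuous p.
Proof.
move=> x; apply: cvgM; first exact: cvg_cst.
apply: continuous_comp; last exact: continuous_expR.
apply: cvgM; last exact: cvg_cst.
apply: cvgN; apply: cvg_norm; apply: cvgB; first exact: cvg_id.
exact: cvg_cst.
Qed.

Lemma measurable_laplace_pdf : measurable_fun setT p.
Proof. by apply: continuous_measurable_fun; exact: continuous_laplace_pdf. Qed.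

(** This proportionality between the tail and the density is the property of
    the Laplace law from which the Stein identity follows. *)
Lemma laplace_pdf_tail t : 0 <= t ->
  (\int[mu]_(x in `[t, +oo[) (p x)%:E = (b * p t)%:E)%E.
Proof.
move=> t0; pose F x : R := - (2^-1 * expR (- b^-1 * x)).
have dF (x : R) : is_derive x (1 : R) F (2^-1 * (b^-1 * expR (- b^-1 * x))).
  have h1 : is_derive x (1 : R) (fun x : R => - b^-1 * x) (- b^-1).
    by apply: is_derive_eq; rewrite /GRing.scale/= mulr1.
  have h2 : is_derive x (1 : R) (fun x : R => expR (- b^-1 * x)) (expR (- b^-1 * x) * - b^-1).
    exact: is_derive1_comp.
  by apply: is_derive_eq; rewrite /GRing.scale/=; ring.
have FE x : 0 <= x -> F x = - (b * p x).
  move=> x0; rewrite /F /laplace_pdf subr0 ger0_norm//.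
  have -> : - b^-1 * x = - x / b by rewrite !mulNr mulrC.
  by field; rewrite gt_eqF.
rewrite (@ge0_continuous_FTC2y _ p F t 0).
- by rewrite FE// EFinN oppeK add0e.
- by move=> x _; exact: laplace_pdf_ge0.
- apply: continuous_subspaceT; exact: continuous_laplace_pdf.
- rewrite -oppr0 -(mulr0 2^-1); apply: cvgN; apply: cvgM; first exact: cvg_cst.
  rewrite (_ : (fun x => expR (- b^-1 * x)) =
               (fun z => expR (- z)) \o (fun z => b^-1 * z)); last first.
    by apply: eq_fun => x; rewrite mulNr.
  apply: (@cvg_comp _ _ _ _ _ _ (pinfty_nbhs R)); last exact: cvgr_expR.
  by apply: gt0_cvgMry => //; rewrite invr_gt0.
- by move=> x _; exact: ex_derive.
- apply: cvg_at_right_filter; apply: differentiable_continuous.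
  by apply/derivable1_diffP; exact: ex_derive.
- move=> x; rewrite in_itv/= andbT => tx.
  rewrite derive1E derive_val /laplace_pdf subr0 gtr0_norm ?(le_lt_trans t0)//.
  have -> : - b^-1 * x = - x / b by rewrite !mulNr mulrC.
  by field; rewrite gt_eqF.
Qed.

Local Notation "\1R+" := (\1_`[0%R, +oo[%classic : R -> R).

(** The integrand u(t) p(x) over 0 <= t <= x, for z = (x, t). *)
Definition half_line_kernel (u : R -> R) (z : R * R) : R :=
  (u z.2 * \1R+ z.2) * (\1R+ (z.1 - z.2) * p z.1).

Lemma measurable_half_line_kernel u : measurable_fun setT u ->
  measurable_fun setT (half_line_kernel u).
Proof.
move=> mu_; apply: measurable_funM; apply: measurable_funM.
- by apply: measurableT_comp => //; exact: measurable_snd.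
- by apply: measurableT_comp; [exact: measurable_indic|exact: measurable_snd].
- apply: measurableT_comp; first exact: measurable_indic.
  by apply: measurable_funB; [exact: measurable_fst|exact: measurable_snd].
- by apply: measurableT_comp; [exact: measurable_laplace_pdf|exact: measurable_fst].
Qed.

Lemma half_line_kernel_int1 (u : R -> R) t :
  (\int[mu]_x (half_line_kernel u (x, t))%:E =
   ((fun t => (b * (u t * p t))%:E) \_ `[0%R, +oo[) t)%E.
Proof.
rewrite patchE; case: ifPn => t0; last first.
  rewrite integral0_eq// => x _; rewrite /half_line_kernel/= indicE.
  by rewrite (negbTE t0) mulr0 mul0r.
have {}t0 : 0 <= t by move: t0; rewrite inE/= in_itv/= andbT.
under eq_integral => x _ do rewrite /half_line_kernel/= EFinM.
have indE x : (\1R+ (x - t) * p x)%:E = ((EFin \o p) \_ `[t, +oo[) x.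
  rewrite patchE indicE !mem_setE/= !in_itv/= !andbT subr_ge0.
  by case: ifPn => tx; rewrite ?mul1r ?mul0r.
under eq_integral => x _ do rewrite indE.
have ip : mu.-integrable `[t, +oo[ (EFin \o p).
  apply/integrableP; split.
    by apply/measurable_EFinP; apply: measurable_funTS; exact: measurable_laplace_pdf.
  under eq_integral do rewrite /= ger0_norm ?laplace_pdf_ge0//.
  by rewrite laplace_pdf_tail// ltry.
rewrite integralZl//; last first.
  by apply/integrable_restrict => //=; rewrite setTI.
rewrite -integral_mkcond laplace_pdf_tail//.
rewrite indicE mem_set/= ?in_itv/= ?t0//.
by rewrite -EFinM; congr EFin; ring.
Qed.

(** Integrating the kernel over t first gives H(x) p(x); integrating it over x
    first gives u(t) times the tail of p at t, which is b p(t). *)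
Lemma half_line_fubini (u H : R -> R) : measurable_fun setT u ->
  (\int[mu]_(t in `[0%R, +oo[) (`|u t| * p t)%:E < +oo)%E ->
  (forall x : R, 0 <= x -> mu.-integrable `[0, x] (EFin \o u) /\
     (\int[mu]_(t in `[0%R, x]) (u t)%:E = (H x)%:E)%E) ->
  mu.-integrable `[0, +oo[ (fun x => (H x * p x)%:E) /\
  (\int[mu]_(x in `[0%R, +oo[) (H x * p x)%:E =
   \int[mu]_(t in `[0%R, +oo[) (b * (u t * p t))%:E)%E.
Proof.
move=> mu_ uoo HE; pose k z := (half_line_kernel u z)%:E.
have mk : measurable_fun setT k.
  by apply/measurable_EFinP; exact: measurable_half_line_kernel.
have norm_k t x : `|k (x, t)|%E = (half_line_kernel (fun t => `|u t|) (x, t))%:E.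
  rewrite /k /half_line_kernel/= 3!normrM (ger0_norm (laplace_pdf_ge0 _)).
  by rewrite !indicE !normr_nat.
have ik : (mu \x mu)%E.-integrable setT k.
  apply/integrable21ltyP => //.
  under eq_integral => t _.
    under eq_integral => x _ do rewrite norm_k.
    rewrite half_line_kernel_int1; over.
  rewrite /= -integral_mkcond.
  under eq_integral do rewrite EFinM.
  rewrite ge0_integralZl//; first by rewrite lte_mul_pinfty ?lee_fin ?(ltW b_gt0).
  - apply/measurable_EFinP; apply: measurable_funTS; apply: measurable_funM.
      exact: measurableT_comp.
    exact: measurable_laplace_pdf.
  - by move=> x _; rewrite lee_fin mulr_ge0// laplace_pdf_ge0.
  - by rewrite lee_fin ltW.
have kE x : (\int[mu]_t k (x, t) = ((fun x => (H x * p x)%:E) \_ `[0%R, +oo[) x)%E.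
  rewrite patchE; case: ifPn => x0; last first.
    rewrite integral0_eq// => t _; rewrite /k /half_line_kernel/= !indicE.
    move: x0; rewrite !mem_setE /= !in_itv/= !andbT subr_ge0 -ltNge => x0.
    have [t0|] := leP 0 t; last by rewrite mulr0 mul0r.
    by rewrite leNgt (lt_le_trans x0 t0) mul0r mulr0.
  have {}x0 : 0 <= x by move: x0; rewrite inE/= in_itv/= andbT.
  have [iu uE] := HE x x0.
  have indE t : k (x, t) = ((p x)%:E * ((EFin \o u) \_ `[0%R, x]) t)%E.
    rewrite /k /half_line_kernel/= patchE !indicE !mem_setE/= !in_itv/= !andbT subr_ge0.
    have [t0|t0] := leP 0 t; have [tx|tx] := leP t x => //=.
    - by rewrite -EFinM; congr EFin; ring.
    - by rewrite mule0 mul0r mulr0.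
    - by rewrite mule0 mulr0 mul0r.
    - by rewrite mule0 mulr0 mul0r.
  under eq_integral => t _ do rewrite indE.
  rewrite integralZl//; last first.
    by apply/integrable_restrict => //=; rewrite setTI.
  by rewrite -integral_mkcond uE -EFinM mulrC.
have iH : mu.-integrable setT ((fun x => (H x * p x)%:E) \_ `[0%R, +oo[).
  by apply: eq_integrable (integrable_fubini_F ik) => // x _; exact: kE.
split; first by move: iH => /integrable_restrict; rewrite setTI; exact.
rewrite [LHS]integral_mkcond [RHS]integral_mkcond.
transitivity (\int[mu]_x \int[mu]_t k (x, t))%E.
  by apply: eq_integral => x _; rewrite kE.
rewrite (Fubini ik).
by apply: eq_integral => t _; rewrite half_line_kernel_int1.
Qed.

End half_line.

Section half_line_identity.
Context {R : realType}.
Local Notation mu := (@lebesgue_measure R).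
Variable b : R.
Hypothesis b_gt0 : 0 < b.
Local Notation p := (laplace_pdf 0 b).

Lemma measurable_integrable_weight (u : R -> R) (D : set (measurableTypeR R)) :
  measurable D -> measurable_fun setT u ->
  (\int[mu]_(t in D) (`|u t| * p t)%:E < +oo)%E ->
  mu.-integrable D (fun t => (u t * p t)%:E).
Proof.
move=> mD mu_ uoo; apply/integrableP; split.
  apply/measurable_EFinP; apply: measurable_funTS; apply: measurable_funM => //.
  exact: measurable_laplace_pdf.
under eq_integral do rewrite /= normrM (ger0_norm (laplace_pdf_ge0 b_gt0 _)).
exact: uoo.
Qed.

(** Exchanging the integrals twice, the integral of (g - g(0)) p is b times that
    of u p, and the integral of (u - u(0)) p is b times that of v p.  What is
    left is u(0) times the mass b p(0) of the half-line. *)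
Lemma half_line_stein (g u v : R -> R) :
  measurable_fun setT u -> measurable_fun setT v ->
  (\int[mu]_(t in `[0%R, +oo[) (`|u t| * p t)%:E < +oo)%E ->
  (\int[mu]_(t in `[0%R, +oo[) (`|v t| * p t)%:E < +oo)%E ->
  (forall x : R, 0 <= x -> mu.-integrable `[0, x] (EFin \o u) /\
     (\int[mu]_(t in `[0%R, x]) (u t)%:E = (g x - g 0)%:E)%E) ->
  (forall x : R, 0 <= x -> mu.-integrable `[0, x] (EFin \o v) /\
     (\int[mu]_(t in `[0%R, x]) (v t)%:E = (u x - u 0)%:E)%E) ->
  (\int[mu]_(x in `[0%R, +oo[) ((g x - g 0 - b ^+ 2 * v x) * p x)%:E =
   (b ^+ 2 * u 0 * p 0)%:E)%E /\
  mu.-integrable `[0, +oo[ (fun x => ((g x - g 0 - b ^+ 2 * v x) * p x)%:E).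
Proof.
move=> mu_ mv uoo voo gu uv.
have [ig gE] := half_line_fubini b_gt0 mu_ uoo gu.
have [iu uE] := half_line_fubini b_gt0 mv voo uv.
have m0oo : measurable (`[0%R, +oo[%classic : set (measurableTypeR R)) by exact: measurable_itv.
have iup := measurable_integrable_weight m0oo mu_ uoo.
have ivp := measurable_integrable_weight m0oo mv voo.
have ip : mu.-integrable `[0, +oo[ (EFin \o p).
  apply/integrableP; split.
    by apply/measurable_EFinP; apply: measurable_funTS; exact: measurable_laplace_pdf.
  under eq_integral do rewrite /= ger0_norm ?laplace_pdf_ge0//.
  by rewrite laplace_pdf_tail// ltry.
have eqf : (fun x => ((g x - g 0 - b ^+ 2 * v x) * p x)%:E) =
    (fun x => ((g x - g 0) * p x)%:E - (b ^+ 2)%:E * (v x * p x)%:E)%E.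
  by apply/funext => x; rewrite -EFinM -EFinB; congr EFin; ring.
have int : mu.-integrable `[0, +oo[ (fun x => ((g x - g 0 - b ^+ 2 * v x) * p x)%:E).
  by rewrite eqf; apply: integrableB => //; exact: integrableZl.
split=> //; rewrite eqf integralB//; last exact: integrableZl.
rewrite integralZl// gE.
have vE : (b%:E * \int[mu]_(x in `[0%R, +oo[) (v x * p x)%:E =
    \int[mu]_(x in `[0%R, +oo[) (u x * p x)%:E - (u 0 * (b * p 0))%:E)%E.
  rewrite -integralZl//; under [LHS]eq_integral do rewrite -EFinM.
  rewrite -uE; under eq_integral do rewrite mulrBl EFinB [(u 0 * _)%:E]EFinM.
  rewrite integralB//; last exact: integrableZl.
  by rewrite integralZl// laplace_pdf_tail// EFinM.
have /fineK ufin := integrable_fin_num m0oo iup.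
have /fineK vfin := integrable_fin_num m0oo ivp.
under [X in (X - _)%E]eq_integral do rewrite EFinM.
rewrite [X in (X - _)%E]integralZl//.
move: vE; rewrite -ufin -vfin -!EFinM -!EFinB => -[vE]; congr EFin.
by rewrite -[X in b * X - _](subrK (u 0 * (b * p 0))) -vE; ring.
Qed.

End half_line_identity.

(** * Reflection and expectations under the Laplace law *)

Section change_of_variables.
Context {R : realType}.
Local Notation mu := (@lebesgue_measure R).

(** Lebesgue measure is invariant under reflection; positive and negative parts
    are treated separately. *)
Lemma integral_opp (f : R -> \bar R) (D : set (measurableTypeR R)) :
  measurable D -> measurable_fun setT f ->
  (\int[mu]_(x in D) f x = \int[mu]_(x in -%R @^-1` D) f (- x)%R)%E.
Proof.
move=> mD mf.
have ge0 (h : R -> \bar R) : measurable_fun setT h -> (forall x, 0 <= h x)%E ->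
    (\int[mu]_(x in D) h x = \int[mu]_(x in -%R @^-1` D) h (- x)%R)%E.
  move=> mh h0.
  transitivity (\int[pushforward mu (-%R : measurableTypeR R -> measurableTypeR R)]_(y in D) h y)%E.
    by apply: eq_measure_integral => //= A mA AS; exact/esym/lebesgue_measureN.
  by rewrite ge0_integral_pushforward//; exact: measurable_funTS.
rewrite [LHS]integralE [RHS]integralE ge0//; last exact: measurable_funepos.
rewrite ge0//; last exact: measurable_funeneg.
by congr (_ - _)%E; apply: eq_integral => x _; rewrite ?funeposE ?funenegE.
Qed.

(** Lebesgue measure lives on the real line seen as the measurable space
    generated by half-open intervals.  The law of [X] is transported to that
    copy of the real line, so that the two measures can be compared. *)
Lemma borel_law d (T : measurableType d) (P : probability T R)
    (X : {RV P >-> R}) :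
  exists2 nu : probability (measurableTypeR R) R,
    forall A, measurable A -> nu A = distribution P X A &
    forall f : R -> \bar R, measurable_fun setT f -> (forall x, 0 <= f x)%E ->
      (\int[P]_t f (X t) = \int[nu]_x f x)%E.
Proof.
have mX : measurable_fun setT (X : T -> measurableTypeR R).
  by move=> _ A mA; rewrite setTI; exact: (measurable_funPTI X).
pose X' : {mfun T >-> measurableTypeR R} :=
  HB.pack (X : T -> measurableTypeR R)
    (isMeasurableFun.Build _ _ _ _ (X : T -> measurableTypeR R) mX).
exists (distribution P X') => // f mf f0.
by rewrite ge0_integral_distribution.
Qed.

(** The Laplace density is the Radon-Nikodym derivative of the law of [W]. *)
Lemma ge0_laplace_integral (b : R) (b_gt0 : 0 < b) d (T : measurableType d)
    (P : probability T R) (W : {RV P >-> R}) (f : R -> \bar R) :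
  laplace_distributed 0 b W -> measurable_fun setT f -> (forall x, 0 <= f x)%E ->
  (\int[P]_t f (W t) = \int[mu]_x (f x * (laplace_pdf 0 b x)%:E))%E.
Proof.
move=> Wb mf f0; have [nu nuW intW] := borel_law W.
have nuE A : measurable A -> nu A = laplace_prob 0 b A.
  by move=> mA; rewrite nuW//; exact: Wb.
have dom : nu `<< mu.
  apply/null_content_dominatesP => A mA A0.
  rewrite nuE// /laplace_prob null_set_integral//.
  apply/measurable_EFinP; apply: measurable_funTS; exact: measurable_laplace_pdf.
rewrite intW//.
rewrite -(Radon_Nikodym_SigmaFinite.change_of_variables dom)//.
have mp := measurable_laplace_pdf b.
have mRN := measurable_int _ (Radon_Nikodym_SigmaFinite.f_integrable dom).
apply: ae_eq_integral => //.
- exact: emeasurable_funM.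
- by apply: emeasurable_funM => //; exact/measurable_EFinP.
- apply: ae_eqe_mul2l; apply: integral_ae_eq => //.
  + exact: Radon_Nikodym_SigmaFinite.f_integrable.
  + exact/measurable_EFinP.
  + by move=> E _ mE; rewrite -(Radon_Nikodym_SigmaFinite.f_integral dom)//; exact: nuE.
Qed.

(** Multiplying by the nonnegative density commutes with taking positive and
    negative parts. *)
Lemma laplace_integral (b : R) (b_gt0 : 0 < b) d (T : measurableType d)
    (P : probability T R) (W : {RV P >-> R}) (f : R -> R) :
  laplace_distributed 0 b W -> measurable_fun setT f ->
  (\int[P]_t (f (W t))%:E = \int[mu]_x (f x * laplace_pdf 0 b x)%:E)%E.
Proof.
move=> Wb mf; have mEf : measurable_fun setT (EFin \o f) by exact/measurable_EFinP.
rewrite [LHS]integralE [RHS]integralE.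
have p0 x : (0 <= (laplace_pdf 0 b x)%:E)%E by rewrite lee_fin laplace_pdf_ge0.
congr (_ - _)%E.
  transitivity (\int[P]_t (EFin \o f)^\+ (W t))%E.
    by apply: eq_integral => t _; rewrite !funeposE.
  rewrite (ge0_laplace_integral b_gt0 Wb (measurable_funepos mEf))//.
  by apply: eq_integral => x _; rewrite !funeposE/= [in RHS]EFinM maxe_pMl ?mul0e.
transitivity (\int[P]_t (EFin \o f)^\- (W t))%E.
  by apply: eq_integral => t _; rewrite !funenegE.
rewrite (ge0_laplace_integral b_gt0 Wb (measurable_funeneg mEf))//.
by apply: eq_integral => x _; rewrite !funenegE/= -mulNr [in RHS]EFinM maxe_pMl ?mul0e.
Qed.

End change_of_variables.

(** * The Stein identity *)

Section stein_identity_line.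
Context {R : realType}.
Local Notation mu := (@lebesgue_measure R).

Lemma opp_preimage_itvNy0 : -%R @^-1` `]-oo, 0%R]%classic = `[0%R, +oo[%classic :> set R.
Proof. by apply/seteqP; split=> x /=; rewrite !in_itv/= oppr_le0 andbT. Qed.

Lemma integrable_opp_itv (w : R -> R) (x : R) : measurable_fun setT w ->
  mu.-integrable `[- x, 0] (EFin \o w) ->
  mu.-integrable `[0, x] (EFin \o (fun t => w (- t))) /\
  (\int[mu]_(t in `[0%R, x]) (w (- t)%R)%:E = \int[mu]_(t in `[(- x)%R, 0%R]) (w t)%:E)%E.
Proof.
move=> mw iw.
have preim : -%R @^-1` `[- x, 0%R]%classic = `[0%R, x]%classic :> set R.
  by rewrite opp_preimage_itvbndbnd/= oppr0 opprK.
have mD : measurable (`[- x, 0%R]%classic : set (measurableTypeR R)) by exact: measurable_itv.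
have mEw : measurable_fun setT (EFin \o w) by exact/measurable_EFinP.
have mEn : measurable_fun setT (abse \o (EFin \o w)) by exact: measurableT_comp.
split; last by rewrite [RHS](integral_opp mD mEw) preim.
apply/integrableP; split.
  by apply/measurable_EFinP; apply: measurable_funTS; exact: measurableT_comp.
by case/integrableP : iw => _; rewrite (integral_opp mD mEn) preim.
Qed.

(** The half-line [0, +oo[ contributes b^2 u(0) p(0).  On the other one the
    reflected function g(- x) has first derivative - u(- x), so the
    contribution is b^2 (- u(0)) p(0). *)
Lemma lebesgue_stein (b : R) (b_gt0 : 0 < b) (g u v : R -> R) :
  measurable_fun setT g -> measurable_fun setT u -> measurable_fun setT v ->
  (\int[mu]_x (`|u x| * laplace_pdf 0 b x)%:E < +oo)%E ->
  (\int[mu]_x (`|v x| * laplace_pdf 0 b x)%:E < +oo)%E ->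
  (forall x y : R, x <= y -> mu.-integrable `[x, y] (EFin \o u) /\
     (\int[mu]_(t in `[x, y]) (u t)%:E = (g y - g x)%:E)%E) ->
  (forall x y : R, x <= y -> mu.-integrable `[x, y] (EFin \o v) /\
     (\int[mu]_(t in `[x, y]) (v t)%:E = (u y - u x)%:E)%E) ->
  (\int[mu]_x ((g x - g 0 - b ^+ 2 * v x) * laplace_pdf 0 b x)%:E = 0)%E.
Proof.
move=> mg mu_ mv uoo voo gu uv.
have mp := measurable_laplace_pdf b.
have p_ge0 := laplace_pdf_ge0 b_gt0.
pose f x := ((g x - g 0 - b ^+ 2 * v x) * laplace_pdf 0 b x)%:E.
have mf : measurable_fun setT f.
  apply/measurable_EFinP; apply: measurable_funM => //.
  apply: measurable_funB; first exact: measurable_funB.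
  exact: measurable_funM.
have mweight (w : R -> R) : measurable_fun setT w ->
    measurable_fun setT (fun x : R => (`|w x| * laplace_pdf 0 b x)%:E).
  move=> mw; apply/measurable_EFinP; apply: measurable_funM => //.
  exact: measurableT_comp.
have m_pos : measurable (`[0%R, +oo[%classic : set (measurableTypeR R)).
  exact: measurable_itv.
have m_neg : measurable (`]-oo, 0%R]%classic : set (measurableTypeR R)).
  exact: measurable_itv.
have wsub (w : R -> R) (D : set (measurableTypeR R)) :
    measurable D -> measurable_fun setT w ->
    (\int[mu]_x (`|w x| * laplace_pdf 0 b x)%:E < +oo)%E ->
    (\int[mu]_(x in D) (`|w x| * laplace_pdf 0 b x)%:E < +oo)%E.
  move=> mD mw; apply: le_lt_trans; apply: ge0_subset_integral => //.
    exact: mweight.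
  by move=> x _; rewrite lee_fin mulr_ge0.
have wopp (w : R -> R) : measurable_fun setT w ->
    (\int[mu]_x (`|w x| * laplace_pdf 0 b x)%:E < +oo)%E ->
    (\int[mu]_(x in `[0%R, +oo[) (`|w (- x)%R| * laplace_pdf 0 b x)%:E < +oo)%E.
  move=> mw woo; have := wsub w _ m_neg mw woo.
  rewrite (integral_opp m_neg (mweight _ mw)) opp_preimage_itvNy0.
  by under eq_integral do rewrite laplace_pdf_even.
have stein_pos :
    (\int[mu]_(x in `[0%R, +oo[) f x = (b ^+ 2 * u 0 * laplace_pdf 0 b 0)%:E)%E.
  apply: (half_line_stein b_gt0 mu_ mv (wsub _ _ m_pos mu_ uoo)
    (wsub _ _ m_pos mv voo) _ _).1 => x x0; [exact: gu|exact: uv].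
have stein_neg : (\int[mu]_(x in `[0%R, +oo[) f (- x)%R =
    (b ^+ 2 * (- u (- 0)) * laplace_pdf 0 b 0)%:E)%E.
  have mop (w : R -> R) : measurable_fun setT w ->
      measurable_fun setT (fun x : R => w (- x)).
    by move=> mw; exact: measurableT_comp.
  have uoo_opp : (\int[mu]_(x in `[0%R, +oo[)
      (`|- u (- x)%R| * laplace_pdf 0 b x)%:E < +oo)%E.
    under eq_integral => x _ do rewrite normrN.
    exact: (wopp u mu_ uoo).
  have mou : measurable_fun setT (fun x : R => - u (- x)).
    by apply: measurableT_comp => //; exact: mop.
  rewrite -[RHS](@half_line_stein R b b_gt0 (fun x => g (- x))
    (fun x => - u (- x)) (fun x => v (- x)) mou (mop _ mv) uoo_opp
    (wopp _ mv voo) _ _).1.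
  - by apply: eq_integral => x _; rewrite /f laplace_pdf_even oppr0.
  - move=> x x0; have x0' : - x <= 0 by rewrite oppr_le0.
    have [iu uE] := gu _ _ x0'; have [iu' uE'] := integrable_opp_itv mu_ iu.
    split; first by apply: (eq_integrable _ _ _ _ (integrableN iu')).
    under eq_integral do rewrite EFinN.
    rewrite integralN; last exact: integrable_add_def.
    by rewrite uE' uE -EFinN opprB oppr0.
  - move=> x x0; have x0' : - x <= 0 by rewrite oppr_le0.
    have [iv vE] := uv _ _ x0'; have [iv' vE'] := integrable_opp_itv mv iv.
    by split=> //; rewrite vE' vE oppr0; congr EFin; ring.
rewrite -/(f _) (setT_split 0) integral_setU//.
- rewrite integral_itv_obnd_cbnd; last exact: measurable_funTS.
  rewrite stein_pos (integral_opp m_neg mf) opp_preimage_itvNy0 stein_neg.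
  by rewrite oppr0 -EFinD; congr EFin; ring.
- exact: measurable_funTS.
- exact: disjoint_split.
Qed.

Lemma laplace_stein (b : R) (b_gt0 : 0 < b) d (T : measurableType d)
    (P : probability T R) (W : {RV P >-> R}) (g : R -> R) :
  laplace_distributed 0 b W ->
  locally_absolutely_continuous g ->
  locally_absolutely_continuous g^`()%classic ->
  ('E_P[fun t => `|g^`()%classic (W t)|%R] < +oo)%E ->
  ('E_P[fun t => `|g^`(2)%classic (W t)|%R] < +oo)%E ->
  ('E_P[fun t => laplace_operator b g (W t)] = 0)%E.
Proof.
move=> Wb acg acu.
have mg : measurable_fun setT g.
  apply: continuous_measurable_fun; exact: absolutely_continuous_continuous.
have mg' : measurable_fun setT g^`()%classic.
  apply: continuous_measurable_fun; exact: absolutely_continuous_continuous.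
have mg'' : measurable_fun setT g^`(2)%classic.
  by apply: measurable_derive1; exact: absolutely_continuous_continuous.
have mA : measurable_fun setT (laplace_operator b g).
  apply: measurable_funB; first exact: measurable_funB.
  exact: measurable_funM.
have mnorm (w : R -> R) : measurable_fun setT w -> measurable_fun setT (fun x => `|w x|).
  by move=> mw; exact: measurableT_comp.
rewrite !unlock (laplace_integral b_gt0 Wb (mnorm _ mg')).
rewrite (laplace_integral b_gt0 Wb (mnorm _ mg'')).
rewrite (laplace_integral b_gt0 Wb mA) => g'oo g''oo.
apply: (lebesgue_stein b_gt0 mg mg' mg'' g'oo g''oo) => x y xy.
  exact: integrable_derive1.
exact: integrable_derive1.
Qed.

End stein_identity_line.

(** * The bounded solution of the Stein equation *)

Section resolvent.
Context {R : realType}.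
Local Notation mu := (@lebesgue_measure R).
Variable b : R.
Hypothesis b_gt0 : 0 < b.
Local Notation p := (laplace_pdf 0 b).
Variables (h : R -> R) (c d : R).
Hypothesis ch : continuous h.
Hypothesis h01 : forall t, 0 <= h t <= 1.
Hypothesis h_out : forall t, ~~ (c < t < d) -> h t = 0.

Lemma compact_support_integrable (w : R -> R) (D : set (measurableTypeR R)) :
  measurable D -> continuous w -> mu.-integrable D (fun t => (w t * h t)%:E).
Proof.
move=> mD cw; have cwh : continuous (fun t => w t * h t).
  by move=> t; apply: cvgM; [exact: cw|exact: ch].
apply: (@integrableS _ _ _ mu setT) => //.
have : mu.-integrable `[c, d] (EFin \o (fun t => w t * h t)).
  by apply: continuous_compact_integrable; [exact: segment_compact|exact: continuous_subspaceT].
rewrite -(setTI `[c, d]%classic) => /integrable_restrict.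
move=> /(_ (measurable_itv _) measurableT).
apply: eq_integrable => // t _; rewrite patchE; case: ifPn => //.
move=> tcd; rewrite h_out ?mulr0//; apply: contra tcd => /andP[ct td].
by rewrite mem_setE in_itv/= !ltW.
Qed.

(** For s = 1 and s = -1 these are the solutions of f = b^2 f''. *)
Definition exp_scale (s x : R) : R := expR (s / b * x).

Lemma continuous_exp_scale s : continuous (exp_scale s).
Proof.
move=> x; apply: continuous_comp; last exact: continuous_expR.
by apply: cvgM; [exact: cvg_cst|exact: cvg_id].
Qed.

Lemma is_derive_exp_scale s (x : R) :
  is_derive x (1 : R) (exp_scale s) (s / b * exp_scale s x).
Proof.
have h1 : is_derive x (1 : R) (fun x : R => s / b * x) (s / b).
  by apply: is_derive_eq; rewrite /GRing.scale/= mulr1.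
have h2 : is_derive x (1 : R) (exp_scale s) (exp_scale s x * (s / b)).
  exact: is_derive1_comp.
by apply: is_derive_eq; rewrite mulrC.
Qed.

Lemma exp_scaleN s x : exp_scale s x * exp_scale (- s) x = 1.
Proof. by rewrite /exp_scale -expRD -mulrDl -mulrDl subrr !mul0r expR0. Qed.

Definition left_mass s (x : R) : R := \int[mu]_(t in `]-oo, x]) (exp_scale s t * h t).

Lemma is_derive_left_mass s (x : R) :
  is_derive x (1 : R) (left_mass s) (exp_scale s x * h x).
Proof.
have xx1 : x < x + 1 by rewrite ltrDl.
have int u : mu.-integrable [set` Interval -oo%O (BRight u)]
    (EFin \o (fun t => exp_scale s t * h t)).
  by apply: compact_support_integrable => //; exact: continuous_exp_scale.
have cx : {for x, continuous (fun t => exp_scale s t * h t)}.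
  by apply: cvgM; [exact: continuous_exp_scale|exact: ch].
have [dF F'] := continuous_FTC1 xx1 (int (x + 1)) (ltNyr _) cx.
by apply: (DeriveDef dF); rewrite -derive1E F'.
Qed.

Definition right_mass s (x : R) : R := \int[mu]_(t in `]x, +oo[) (exp_scale s t * h t).

Lemma left_right_mass s x : left_mass s x + right_mass s x =
  \int[mu]_t (exp_scale s t * h t).
Proof.
rewrite /left_mass /right_mass [in RHS](setT_split x) Rintegral_setU//.
- by rewrite -setT_split; apply: compact_support_integrable => //; exact: continuous_exp_scale.
- exact: disjoint_split.
Qed.

Lemma is_derive_right_mass s (x : R) :
  is_derive x (1 : R) (right_mass s) (- (exp_scale s x * h x)).
Proof.
have -> : right_mass s = cst (\int[mu]_t (exp_scale s t * h t)) - left_mass s.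
  by apply/funext => y; rewrite !fctE -(left_right_mass s y) addrAC subrr add0r.
have h1 := is_derive_left_mass s x.
by apply: is_derive_eq; rewrite sub0r.
Qed.

(** The convolution of [h] with the Laplace density, the Green function of
    1 - b^2 D^2.  It is split at [x] so that each half is an exponential times
    an integral with one moving endpoint. *)
Definition resolvent (x : R) : R := (2 * b)^-1 *
  (exp_scale (-1) x * left_mass 1 x + exp_scale 1 x * right_mass (-1) x).

(** The derivative of [resolvent], where the two boundary terms cancel. *)
Definition resolvent' (x : R) : R := (2 * b ^+ 2)^-1 *
  (exp_scale 1 x * right_mass (-1) x - exp_scale (-1) x * left_mass 1 x).

Lemma is_derive_resolvent (x : R) : is_derive x (1 : R) resolvent (resolvent' x).
Proof.
have l := is_derive_left_mass 1 x; have r := is_derive_right_mass (-1) x.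
have e1 := is_derive_exp_scale 1 x; have e2 := is_derive_exp_scale (-1) x.
apply: is_derive_eq; rewrite /resolvent' /GRing.scale/=.
by field; rewrite gt_eqF.
Qed.

Lemma is_derive_resolvent' (x : R) :
  is_derive x (1 : R) resolvent' ((resolvent x - h x) / b ^+ 2).
Proof.
have l := is_derive_left_mass 1 x; have r := is_derive_right_mass (-1) x.
have e1 := is_derive_exp_scale 1 x; have e2 := is_derive_exp_scale (-1) x.
apply: is_derive_eq; rewrite /resolvent /GRing.scale/=.
have := exp_scaleN 1 x.
set u := exp_scale 1 x; set v := exp_scale (-1) x => uv.
apply/eqP; rewrite -subr_eq0; apply/eqP.
transitivity ((1 - u * v) * h x / b ^+ 2); last by rewrite uv subrr !mul0r.
by field; rewrite gt_eqF.
Qed.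

Local Notation total := (\int[mu]_t h t).

Lemma integrable_support (D : set (measurableTypeR R)) : measurable D ->
  mu.-integrable D (EFin \o h).
Proof.
move=> mD; have : mu.-integrable D (fun t => (cst (1 : R) t * h t)%:E).
  by apply: compact_support_integrable => // t; exact: cvg_cst.
by apply: eq_integrable => // t _; rewrite /= mul1r.
Qed.

(** On [D] the exponential is at most its value at [x], which the factor in
    front of the integral cancels. *)
Lemma mass_bound s (x : R) (D : set (measurableTypeR R)) : measurable D ->
  (forall t, D t -> exp_scale s t <= exp_scale s x) ->
  0 <= exp_scale (- s) x * (\int[mu]_(t in D) (exp_scale s t * h t)) <= total.
Proof.
move=> mD Dx; have h0 t : 0 <= h t by case/andP: (h01 t).
have e0 y s' : 0 <= exp_scale s' y by exact: expR_ge0.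
apply/andP; split.
  by apply: mulr_ge0 => //; apply: Rintegral_ge0 => t _; exact: mulr_ge0.
have -> : total = exp_scale (- s) x * (exp_scale s x * total).
  by rewrite mulrA [X in X * _]mulrC exp_scaleN mul1r.
apply: ler_wpM2l => //.
apply: (@le_trans _ _ (\int[mu]_(t in D) (exp_scale s x * h t))).
  apply: le_Rintegral => //.
  - by apply: compact_support_integrable => //; exact: continuous_exp_scale.
  - have : mu.-integrable D (fun t => (cst (exp_scale s x) t * h t)%:E).
      by apply: compact_support_integrable => // t; exact: cvg_cst.
    exact.
  - by move=> t Dt; apply: ler_wpM2r => //; exact: Dx.
rewrite RintegralZl//; last exact: integrable_support.
apply: ler_wpM2l => //; apply: fine_le.
- by apply: integrable_fin_num => //; exact: integrable_support.
- by apply: integrable_fin_num => //; exact: integrable_support.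
- apply: ge0_subset_integral => //.
    by apply/measurable_EFinP; exact: continuous_measurable_fun.
  by move=> t _; rewrite lee_fin.
Qed.

Lemma exp_scale_le s (x y : R) : s * x <= s * y -> exp_scale s x <= exp_scale s y.
Proof.
move=> sxy; rewrite /exp_scale ler_expR mulrAC [leRHS]mulrAC.
by apply: ler_wpM2r => //; rewrite invr_ge0 ltW.
Qed.

Lemma left_mass_bound x : 0 <= exp_scale (-1) x * left_mass 1 x <= total.
Proof.
apply: mass_bound => //= t; rewrite in_itv/= => tx.
by apply: exp_scale_le; rewrite !mul1r.
Qed.

Lemma right_mass_bound x : 0 <= exp_scale 1 x * right_mass (-1) x <= total.
Proof.
rewrite -[X in exp_scale X x](opprK 1); apply: mass_bound => //= t.
rewrite in_itv/= andbT => xt.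
by apply: exp_scale_le; rewrite !mulN1r lerN2 ltW.
Qed.

Lemma sup_norm_lty (f : R -> R) (M : R) : (forall x, `|f x| <= M) ->
  (sup_norm f < +oo)%E.
Proof.
move=> fM; apply: (@le_lt_trans _ _ M%:E); last exact: ltry.
by apply: ge_ereal_sup => _ [x _ <-]; rewrite lee_fin.
Qed.

Lemma resolvent_bound x : `|resolvent x| <= (2 * b)^-1 * (total + total).
Proof.
rewrite /resolvent normrM ger0_norm; last by rewrite invr_ge0 mulr_ge0// ltW.
apply: ler_wpM2l; first by rewrite invr_ge0 mulr_ge0// ltW.
have /andP[l0 l1] := left_mass_bound x; have /andP[r0 r1] := right_mass_bound x.
by rewrite (ger0_norm (addr_ge0 l0 r0)); exact: lerD.
Qed.

Lemma resolvent'_bound x : `|resolvent' x| <= (2 * b ^+ 2)^-1 * total.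
Proof.
have b2 : 0 <= (2 * b ^+ 2)^-1 by rewrite invr_ge0 mulr_ge0// exprn_ge0// ltW.
rewrite /resolvent' normrM (ger0_norm b2).
apply: ler_wpM2l => //.
have /andP[l0 l1] := left_mass_bound x; have /andP[r0 r1] := right_mass_bound x.
by rewrite ler_norml; apply/andP; split; lra.
Qed.

Lemma derive1_resolvent : resolvent^`()%classic = resolvent'.
Proof.
by apply/funext => x; rewrite derive1E; have := is_derive_resolvent x => ?; rewrite derive_val.
Qed.

Lemma derive2_resolvent x : resolvent^`(2)%classic x = (resolvent x - h x) / b ^+ 2.
Proof.
rewrite /derive1n/= derive1_resolvent derive1E.
by have := is_derive_resolvent' x => ?; rewrite derive_val.
Qed.

Lemma laplace_operator_resolvent x : laplace_operator b resolvent x = h x - resolvent 0.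
Proof.
rewrite /laplace_operator derive2_resolvent; field; rewrite ?gt_eqF//.
Qed.

(** The density is even, so the convolution at 0 is an integral against it. *)
Lemma resolvent0 : (\int[mu]_t (h t * p t)%:E = (resolvent 0)%:E)%E.
Proof.
have ip D : measurable D -> mu.-integrable D (fun t => (h t * p t)%:E).
  move=> mD; have : mu.-integrable D (fun t => (p t * h t)%:E).
    by apply: compact_support_integrable => //; exact: continuous_laplace_pdf.
  by apply: eq_integrable => // t _; rewrite mulrC.
rewrite -[LHS]fineK; last exact: integrable_fin_num (ip _ measurableT).
congr EFin; rewrite -/(Rintegral _ _ _) (setT_split 0) Rintegral_setU//; last first.
- exact: disjoint_split.
- by rewrite -setT_split; exact: ip.
rewrite /resolvent /exp_scale !mulr0 expR0 !mul1r mulrDr; congr (_ + _).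
  rewrite -RintegralZl//; last first.
    by apply: compact_support_integrable => //; exact: continuous_exp_scale.
  apply: eq_Rintegral => t; rewrite inE/= in_itv/= => t0.
  rewrite /laplace_pdf /exp_scale subr0 ler0_norm// opprK.
  by rewrite [t / b]mulrC mul1r; ring.
rewrite -RintegralZl//; last first.
  by apply: compact_support_integrable => //; exact: continuous_exp_scale.
apply: eq_Rintegral => t; rewrite inE/= in_itv/= andbT => t0.
rewrite /laplace_pdf /exp_scale subr0 gtr0_norm//.
have -> : -1 / b * t = - t / b by rewrite mulN1r !mulNr mulrC.
by ring.
Qed.

(** The operator sends the resolvent to h - resolvent 0, so the hypothesis says
    that E[h(X)] = resolvent 0. *)
Lemma resolvent_expectation d' (T : measurableType d') (P : probability T R)
    (X : {RV P >-> R}) :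
  ('E_P[fun t => laplace_operator b resolvent (X t)] = 0)%E ->
  (\int[P]_t (h (X t))%:E = \int[mu]_t (h t * p t)%:E)%E.
Proof.
rewrite unlock resolvent0.
under eq_integral do rewrite laplace_operator_resolvent EFinB.
have mh : measurable_fun setT h by exact: continuous_measurable_fun.
have ih : P.-integrable setT (fun t => (h (X t))%:E).
  apply: measurable_bounded_integrable => //.
  - by rewrite ltey_eq fin_num_measure.
  - by apply: measurableT_comp.
  - exists 1; split=> // M M1 t _ /=; apply: le_trans (ltW M1).
    by have /andP[h0 h1] := h01 (X t); rewrite ger0_norm.
rewrite integralB//; last exact: finite_measure_integrable_cst.
rewrite integral_cst//= probability_setT mule1.
have /fineK <- := integrable_fin_num measurableT ih.
by rewrite -EFinB => -[] /eqP; rewrite subr_eq0 => /eqP ->.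
Qed.

End resolvent.

(** * Characterisation of the Laplace law *)

Section bump.
Context {R : realType}.
Local Notation mu := (@lebesgue_measure R).
Variables (c d : R).

(** A trapezoid of slope [n] on ]c, d[ that increases to the indicator of
    ]c, d[. *)
Definition bump (n : nat) (t : R) : R :=
  Num.min 1 (n%:R * Num.max 0 (Num.min (t - c) (d - t))).

Lemma continuous_bump n : continuous (bump n).
Proof.
move=> t; apply: (@continuous_min _ _ (cst 1)
  (fun t => n%:R * Num.max 0 (Num.min (t - c) (d - t)))).
  exact: cvg_cst.
apply: cvgM; first exact: cvg_cst.
apply: (@continuous_max _ _ (cst 0) (fun t => Num.min (t - c) (d - t))).
  exact: cvg_cst.
apply: (@continuous_min _ _ (fun t => t - c) (fun t => d - t)).
  by apply: cvgB; [exact: cvg_id|exact: cvg_cst].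
by apply: cvgB; [exact: cvg_cst|exact: cvg_id].
Qed.

Lemma bump01 n t : 0 <= bump n t <= 1.
Proof. by rewrite /bump le_min ler01 mulr_ge0//= ?ge_min ?lexx// le_max lexx. Qed.

Lemma bump_out n t : ~~ (c < t < d) -> bump n t = 0.
Proof.
move=> tcd; rewrite /bump; suff -> : Num.max 0 (Num.min (t - c) (d - t)) = 0.
  by rewrite mulr0 min_r.
by apply/max_idPl; rewrite ge_min !subr_le0 !leNgt -negb_and.
Qed.

Lemma bump_nondecreasing t : {homo bump^~ t : n m / (n <= m)%N >-> n <= m}.
Proof.
move=> n m nm; rewrite /bump le_min !ge_min lexx/=; apply/orP; right.
by apply: ler_wpM2r; rewrite ?ler_nat// le_max lexx.
Qed.

Lemma bump_cvg t : bump n t @[n --> \oo] --> (\1_`]c, d[%classic t : R).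
Proof.
rewrite indicE mem_setE in_itv/=; have [tcd|tcd] := boolP (c < t < d); last first.
  by under eq_fun do rewrite bump_out//; exact: cvg_cst.
apply: cvg_near_cst.
have m0 : 0 < Num.min (t - c) (d - t) by rewrite lt_min !subr_gt0.
near=> n; rewrite /bump; apply/min_idPl.
rewrite (max_idPr (ltW m0)) -ler_pdivrMr// div1r.
near: n; exact: nbhs_infty_ger.
Unshelve. all: by end_near. Qed.

End bump.

Section uniqueness.
Context {R : realType}.
Local Notation mu := (@lebesgue_measure R).

(** Monotone convergence.  The weight [w] serves to cover both the expectation
    of a bump at [X] and the integral of a bump against the Laplace density. *)
Lemma bump_integral_cvg (c d : R) d' (T : measurableType d')
    (m : {measure set T -> \bar R}) (Y w : T -> R) :
  measurable_fun setT Y -> measurable_fun setT w -> (forall t, 0 <= w t) ->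
  (\int[m]_t (\1_`]c, d[%classic (Y t) * w t)%:E =
   limn (fun n => \int[m]_t (bump c d n (Y t) * w t)%:E))%E.
Proof.
move=> mY mw w0; rewrite -monotone_convergence//.
- apply: eq_integral => t _; apply/esym/cvg_lim => //; apply: cvg_EFin; first exact: nearW.
  by apply: cvgM; [exact: bump_cvg|exact: cvg_cst].
- move=> n; apply/measurable_EFinP; apply: measurable_funM => //.
  apply: measurableT_comp => //; apply: continuous_measurable_fun.
  exact: continuous_bump.
- by move=> n t _; rewrite lee_fin mulr_ge0//; have /andP[] := bump01 c d n (Y t).
- move=> t _ n k nk; rewrite lee_fin; apply: ler_wpM2r => //.
  exact: bump_nondecreasing.
Qed.

(** Resolvents of bumps are admissible test functions, so the law of [X] and the
    Laplace law agree on bounded open intervals.  These are stable under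
    intersection, generate the Borel sets and exhaust the real line. *)
Lemma laplace_stein_converse (b : R) (b_gt0 : 0 < b) d (T : measurableType d)
    (P : probability T R) (X : {RV P >-> R}) :
  (forall g : R -> R,
     twice_differentiable g ->
     (sup_norm g < +oo)%E ->
     (sup_norm g^`()%classic < +oo)%E ->
     (sup_norm g^`(2)%classic < +oo)%E ->
     ('E_P[fun t => laplace_operator b g (X t)] = 0)%E) ->
  laplace_distributed 0 b X.
Proof.
move=> H.
have mp := measurable_laplace_pdf b.
have p0 := laplace_pdf_ge0 b_gt0.
have bumpE c e n : (\int[P]_t (bump c e n (X t))%:E =
    \int[mu]_t (bump c e n t * laplace_pdf 0 b t)%:E)%E.
  have cb := @continuous_bump R c e n; have b01 := bump01 c e n.
  have bo := @bump_out R c e n.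
  apply: (resolvent_expectation b_gt0 cb b01 bo); apply: H.
  - move=> x; split.
      by have := is_derive_resolvent b_gt0 cb bo x => -[].
    rewrite (derive1_resolvent b_gt0 cb bo).
    by have := is_derive_resolvent' b_gt0 cb bo x => -[].
  - exact: sup_norm_lty (resolvent_bound b_gt0 cb b01 bo).
  - rewrite (derive1_resolvent b_gt0 cb bo).
    exact: sup_norm_lty (resolvent'_bound b_gt0 cb b01 bo).
  - pose K := Rintegral mu setT (bump c e n).
    apply: (@sup_norm_lty _ _ (((2 * b)^-1 * (K + K) + 1) / b ^+ 2)) => x.
    rewrite (derive2_resolvent b_gt0 cb bo) normrM [X in _ * X]ger0_norm; last first.
      by rewrite invr_ge0 exprn_ge0// ltW.
    apply: ler_wpM2r; first by rewrite invr_ge0 exprn_ge0// ltW.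
    apply: le_trans (ler_normB _ _) _; apply: lerD.
      exact: (resolvent_bound b_gt0 cb b01 bo).
    by have /andP[h0 h1] := b01 x; rewrite ger0_norm.
have PE c e : distribution P X `]c, e[%classic = laplace_prob 0 b `]c, e[%classic.
  transitivity (\int[P]_t (\1_`]c, e[%classic (X t) * cst 1 t)%:E)%E.
    under eq_integral do rewrite mulr1.
    rewrite (_ : (fun t => _) = (fun t => (\1_(X @^-1` `]c, e[%classic) t)%:E))//.
    rewrite integral_indic ?setIT//.
    exact: (measurable_funPTI X (measurable_itv _)).
  rewrite bump_integral_cvg//.
  under eq_fun do under eq_integral do rewrite mulr1.
  under eq_fun do rewrite bumpE.
  rewrite -(bump_integral_cvg c e mu (@measurable_id _ _ setT) mp p0).
  rewrite /laplace_prob [RHS]integral_mkcond; apply: eq_integral => t _.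
  by rewrite patchE indicE; case: ifPn; rewrite ?mul1r ?mul0r.
have [nu nuX _] := borel_law X.
pose L : set (measurableTypeR R) -> \bar R := laplace_prob 0 b.
have mEp (D : set (measurableTypeR R)) : measurable_fun D (EFin \o laplace_pdf 0 b).
  by apply/measurable_EFinP; exact: measurable_funTS.
have L0 : L set0 = 0%E by rewrite /L /laplace_prob integral_set0.
have L_ge0 A : (0 <= L A)%E by apply: integral_ge0 => x _; rewrite lee_fin.
have L_sigma : semi_sigma_additive L.
  move=> /= F mF tF mUF; rewrite /L /laplace_prob; apply: cvg_toP.
    apply: ereal_nondecreasing_is_cvgn => m n mn.
    apply: lee_sum_nneg_natr => // k _ _; apply: integral_ge0 => /= x Fkx.
    by rewrite lee_fin.
  by rewrite ge0_integral_bigcup//= => x _; rewrite lee_fin.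
pose mL : {measure set (measurableTypeR R) -> \bar R} :=
  HB.pack L (isMeasure.Build _ _ _ L L0 L_ge0 L_sigma).
move=> A mA.
rewrite -nuX// -[RHS]/(mL A).
have G_measurable : (R.-ocitv.-measurable).-sigma.-measurable = <<s @RGenOpens.G R >>.
  exact: RGenOpens.measurableE.
have G_setI : setI_closed (@RGenOpens.G R).
  move=> _ _ [x [y ->]] [x' [y' ->]].
  exists (Num.max x x'), (Num.min y y'); apply/seteqP; split=> t /=;
    rewrite !in_itv/= gt_max lt_min.
    by move=> [/andP[-> ->] /andP[-> ->]].
  by move=> /andP[/andP[-> ->] /andP[-> ->]].
pose I (k : nat) : set (measurableTypeR R) := `](- k%:R)%R, k%:R[%classic.
have I_G k : @RGenOpens.G R (I k) by exists (- k%:R), k%:R.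
have I_cover : \bigcup_k I k = setT.
  rewrite -subTset => x _; exists (Num.truncn `|x|).+1 => //=.
  by rewrite /I /= in_itv/= -ltr_norml truncnS_gt.
have eqG B : @RGenOpens.G R B -> nu B = mL B.
  by move=> [x [y ->]]; rewrite nuX; [exact: PE|exact: measurable_itv].
have fin k : (nu (I k) < +oo)%E.
  by rewrite ltey_eq fin_num_measure//; exact: measurable_itv.
exact: (measure_unique _ _ G_measurable G_setI I_G I_cover _ _ eqG fin _ mA).
Qed.

End uniqueness.

Unset Implicit Arguments.

Theorem theorem1p1 (R : realType) (b : R) (b_gt0 : 0 < b) :
  (forall (d : measure_display) (T : measurableType d) (P : probability T R)
          (W : {RV P >-> R}),
     laplace_distributed 0 b W ->
     forall g : R -> R,
       locally_absolutely_continuous g ->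
       locally_absolutely_continuous g^`()%classic ->
       ('E_P[fun t => `|g^`()%classic (W t)|%R] < +oo)%E ->
       ('E_P[fun t => `|g^`(2)%classic (W t)|%R] < +oo)%E ->
       ('E_P[fun t => laplace_operator b g (W t)] = 0)%E)
  /\
  (forall (d : measure_display) (T : measurableType d) (P : probability T R)
          (X : {RV P >-> R}),
     (forall g : R -> R,
        twice_differentiable g ->
        (sup_norm g < +oo)%E ->
        (sup_norm g^`()%classic < +oo)%E ->
        (sup_norm g^`(2)%classic < +oo)%E ->
        ('E_P[fun t => laplace_operator b g (X t)] = 0)%E) ->
     laplace_distributed 0 b X).
Proof.
split=> d T P X.
  by move=> Wb g acg acg' ig ig'; exact: laplace_stein.
exact: laplace_stein_converse.
Qed.
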